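(* For any mixture $\nu$ and any integer $k\ge0$, the $k$-complexity function $\theta_{k,\nu}$ satisfies: (1) $\theta_{k,\nu}$ is continuous on $\mathbb{R}$ and differentiable on $\mathbb{R}\setminus\{-E_\infty\}$. (2) $\theta_{k,\nu}$ is strictly increasing on $(-\infty,-E'_\infty)$ and strictly decreasing on $(-E'_\infty,\infty)$. Its unique maximum is independent of $k$ and equal to $$\Sigma_\nu:=\theta_{k,\nu}(-E'_\infty)=\frac12\log\frac{\nu''}{\nu'}-\frac{\nu''-\nu'}{\nu''+\nu'}>0.$$ (3) $\theta_{k,\nu}$ has exactly two distinct zeros. The largest zero is $-E_\infty^-$, and is therefore independent of $k$. (4) For any $k,k'\ge0$ with $k<k'$, $\theta_{k,\nu}(u)>\theta_{k',\nu}(u)$ for all $u\in(-\infty,-E_\infty)$. (5) For any $k,k'\ge0$ with $k<k'$, $\theta_{k,\nu}(u)=\theta_{k',\nu}(u)$ for all $u\in[-E_\infty,\infty)$.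
   Context: A mixture is $\nu(t)=\sum_{p\ge2}\beta_p^2t^p$, where $(\beta_p)_{p\ge2}$ are nonnegative reals with $\sum_{p\ge2}2^p\beta_p<\infty$ and $\sum_{p\ge2}\beta_p^2=1$. Write $\nu'=\nu'(1)$, $\nu''=\nu''(1)$, $\alpha^2=\nu''+\nu'-\nu'^2\ge0$. The mixture is pure if $\nu(t)=t^p$ for a single $p$; this is equivalent to $\alpha=0$. Thresholds: $E'_\infty=\dfrac{2\nu'\sqrt{\nu''}}{\nu'+\nu''}$, $E_\infty=\dfrac{2\nu''-\alpha^2}{\nu'\sqrt{\nu''}}$, and $$E_\infty^{-}=\frac{2\nu'\sqrt{\nu''}-\sqrt{4\nu''\nu'^2-(\nu''+\nu')\left(2(\nu''-\nu'+\nu'^2)-\alpha^2\log\frac{\nu''}{\nu'}\right)}}{\nu'+\nu''}.$$ Complexity functions. Let $$F(\lambda,y)=\frac12\left(-\frac{\nu''+\nu'}{\alpha^2}y^2+\frac{2\sqrt2\sqrt{\nu''}\,\nu'}{\alpha^2}\lambda y-\frac{\nu''-\nu'+\nu'^2}{\alpha^2}\lambda^2\right),\qquad I_1(x)=\int_{\sqrt2}^x\sqrt{z^2-2}\,dz\quad(x\ge\sqrt2).$$ For $u\ge-E_\infty$: $\theta_{k,\nu}(u)=\frac12\log\frac{\nu''}{\nu'}+F(-\sqrt2,u)$. For $u<-E_\infty$: $\theta_{k,\nu}(u)=\frac12\log\frac{\nu''}{\nu'}+F(\lambda_k^*[u],u)-(k+1)I_1(|\lambda_k^*[u]|)$, where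 $\lambda_k^*[u]$ is the unique $\lambda$ with $\frac{\nu'\sqrt{2\nu''}\,u}{\nu''-\nu'+\nu'^2}<\lambda\le-\sqrt2$ and $\frac{\nu'\sqrt{2\nu''}}{\alpha^2}u-\frac{\nu''-\nu'+\nu'^2}{\alpha^2}\lambda+(k+1)\sqrt{\lambda^2-2}=0$. These formulas are written for $\alpha\neq0$; the complexity functions of the pure case ($\alpha=0$) are obtained from them by taking $\alpha\to0$.
   Formalization: For pure ν (α=0) the α→0 limit of θ is −∞ on (−E∞,∞), so continuity at −E∞, differentiability beyond it, strict decrease and the second zero −E∞⁻ fail and are dropped; Σ>0 and a single zero below −E∞⁻ are claimed only if ν'≠ν'' (for t², Σ=0). For α≠0 all items stand. *)

(* Defs.v *)
(* Stdlib reals with Coquelicot. *)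
From Stdlib Require Import Reals.
From Coquelicot Require Import Coquelicot.
Open Scope R_scope.

(* The coefficients (beta_p)_{p >= 2} are stored as a sequence on nat whose
   entries of index 0 and 1 vanish. *)
Record mixture (beta : nat -> R) : Prop := Mixture {
  mixture_0 : beta 0%nat = 0;
  mixture_1 : beta 1%nat = 0;
  mixture_ge0 : forall p : nat, 0 <= beta p;
  mixture_ex_series : ex_series (fun p : nat => 2 ^ p * beta p);
  mixture_series : is_series (fun p : nat => beta p ^ 2) 1
}.

(* For a mixture the radius of convergence is at least 4, so the derivatives at 1
   below are genuine. *)
Definition nu (beta : nat -> R) (t : R) : R :=
  PSeries (fun p : nat => beta p ^ 2) t.

Definition nu1 (beta : nat -> R) : R := Derive (nu beta) 1.
Definition nu2 (beta : nat -> R) : R := Derive_n (nu beta) 2 1.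

(* This is alpha^2; alpha itself occurs only through its square. *)
Definition alpha2 (beta : nat -> R) : R :=
  nu2 beta + nu1 beta - nu1 beta ^ 2.

Definition E'_inf (beta : nat -> R) : R :=
  2 * nu1 beta * sqrt (nu2 beta) / (nu1 beta + nu2 beta).

Definition E_inf (beta : nat -> R) : R :=
  (2 * nu2 beta - alpha2 beta) / (nu1 beta * sqrt (nu2 beta)).

Definition E_inf_minus (beta : nat -> R) : R :=
  (2 * nu1 beta * sqrt (nu2 beta)
   - sqrt (4 * nu2 beta * nu1 beta ^ 2
           - (nu2 beta + nu1 beta)
             * (2 * (nu2 beta - nu1 beta + nu1 beta ^ 2)
                - alpha2 beta * ln (nu2 beta / nu1 beta))))
  / (nu1 beta + nu2 beta).

Definition F (beta : nat -> R) (lambda y : R) : R :=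
  1 / 2 *
  (- ((nu2 beta + nu1 beta) / alpha2 beta) * y ^ 2
   + 2 * sqrt 2 * sqrt (nu2 beta) * nu1 beta / alpha2 beta * lambda * y
   - (nu2 beta - nu1 beta + nu1 beta ^ 2) / alpha2 beta * lambda ^ 2).

Definition I1 (x : R) : R := RInt (fun z : R => sqrt (z ^ 2 - 2)) (sqrt 2) x.

(* [iota P] is the unique element satisfying [P] whenever there is one
   ([iota_correct]). *)
Definition lambda_star (beta : nat -> R) (k : nat) (u : R) : R :=
  iota (fun lambda : R =>
    nu1 beta * sqrt (2 * nu2 beta) * u
      / (nu2 beta - nu1 beta + nu1 beta ^ 2) < lambda /\
    lambda <= - sqrt 2 /\
    nu1 beta * sqrt (2 * nu2 beta) / alpha2 beta * u
      - (nu2 beta - nu1 beta + nu1 beta ^ 2) / alpha2 beta * lambda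
      + (INR k + 1) * sqrt (lambda ^ 2 - 2) = 0).

(* Meaningful only when [alpha2 beta <> 0]. *)
Definition theta (beta : nat -> R) (k : nat) (u : R) : R :=
  if Rle_dec (- E_inf beta) u
  then 1 / 2 * ln (nu2 beta / nu1 beta) + F beta (- sqrt 2) u
  else 1 / 2 * ln (nu2 beta / nu1 beta) + F beta (lambda_star beta k u) u
       - (INR k + 1) * I1 (Rabs (lambda_star beta k u)).

Definition Sigma (beta : nat -> R) : R :=
  1 / 2 * ln (nu2 beta / nu1 beta)
  - (nu2 beta - nu1 beta) / (nu2 beta + nu1 beta).

(* The filter "alpha -> 0 towards beta": mixtures with alpha <> 0 whose alpha^2
   tends to 0 and whose coefficients tend uniformly to those of beta. The first
   condition alone would not determine the limiting pure mixture. *)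
Definition alpha_to_0 (beta : nat -> R) (P : (nat -> R) -> Prop) : Prop :=
  exists eps : posreal, forall b : nat -> R,
    mixture b -> alpha2 b <> 0 -> alpha2 b < eps ->
    (forall p : nat, Rabs (b p - beta p) < eps) -> P b.

(* The parameters nu', nu'' and alpha are not independent, so the limit is taken
   along actual mixtures rather than in alpha alone with nu', nu'' fixed. It may
   be -oo, hence the codomain [Rbar]. *)
Definition is_pure_complexity (beta : nat -> R) (k : nat) (f : R -> Rbar) : Prop :=
  forall u : R,
    filterlim (fun b : nat -> R => theta b k u) (alpha_to_0 beta)
      (Rbar_locally (f u)).

(* Main.v *)
Require Import Defs.
From Stdlib Require Import Reals Lra Psatz Arith Classical.
From Coquelicot Require Import Coquelicot.
Open Scope R_scope.

(** Write a = nu', b = nu'', A = alpha^2 = b + a - a^2, D = b - a + a^2, K = k + 1 and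
    h = sqrt (x^2 - 2) with x = - lambda.  Since nu is the generating function of the
    probability weights beta_p^2 on the exponents p >= 2, a is their mean and A their
    variance; hence a >= 2, A >= 0, and b - a = A + a (a - 2).

    Call - E_inf the threshold.  Above it, completing the square turns theta into the parabola
    Sigma - (a + b) / (2 A) (u + E'_inf)^2 ([upper_branchE]).  As
    E_inf - E'_inf is a positive multiple of (b - a) A, its vertex lies above the
    threshold, and its larger root is - E_inf_minus ([E_inf_minus_root]).

    Below the threshold, the equation of lambda_k^* reads
    x + (K A / D) h = sqrt 2 (- u / E_inf).  Its left side increases with x, so it has one
    solution, and x = sqrt 2 cosh t makes it a quadratic equation in exp t; this gives an
    explicit x ([saddle]), continuous in all the data.  The equation expresses u through
    x, and eliminating u from F makes the factor 1 / A disappear ([saddle_valueE]):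
    theta = 1/2 log (b / a) - Q(x) - K I_1(x), where Q has nonnegative coefficients in
    x^2, x h and h^2 ([saddle_value]).  As x decreases when u increases, theta is strictly
    increasing in u without any differentiation ([lower_branch_lt]), and it tends to minus
    infinity with u because I_1 grows at least linearly.  The two branches agree at the
    threshold; this gives continuity, monotonicity and, with Sigma > 0, exactly two zeros.

    The saddle point maximizes F(-x, u) - K I_1(x) over x >= sqrt 2, by concavity
    ([saddle_max]).  A larger k lowers this function by a multiple of I_1(x) > 0, so the
    maximum decreases strictly with k.

    In the pure case, the regular form of the lower branch passes to the limit as it
    stands ([lim_lower_branch]), while the parabola tends to minus infinity above the
    threshold.  The delicate point is the threshold of the pure mixture itself: it may lie
    on either side of the threshold of a nearby mixture, and the parabola has the
    limit Sigma there only if E'_inf moves by o(alpha).  It does: weight can leave the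
    exponent p of the pure mixture only by creating variance, and Cauchy-Schwarz gives
    (nu' - p)^2 = o(alpha^2) ([mean_deviation], [lim_E'_inf_increment]). *)

(** * Limits along a filter *)

Lemma lim_comp {T : Type} (F : (T -> Prop) -> Prop) (g : R -> R) (f : T -> R) (l : R) :
  continuous g l -> filterlim f F (locally l) ->
  filterlim (fun t => g (f t)) F (locally (g l)).
Proof. intros Hg Hf. exact (filterlim_comp _ _ _ f g _ _ _ Hf Hg). Qed.

Section Limits.
Context {T : Type} {F : (T -> Prop) -> Prop} {FF : Filter F}.

Lemma lim_plus (f g : T -> R) (lf lg : R) :
  filterlim f F (locally lf) -> filterlim g F (locally lg) ->
  filterlim (fun t => f t + g t) F (locally (lf + lg)).
Proof. intros Hf Hg. exact (filterlim_comp_2 _ _ _ Hf Hg (filterlim_plus lf lg)). Qed.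

Lemma lim_mult (f g : T -> R) (lf lg : R) :
  filterlim f F (locally lf) -> filterlim g F (locally lg) ->
  filterlim (fun t => f t * g t) F (locally (lf * lg)).
Proof. intros Hf Hg. exact (filterlim_comp_2 _ _ _ Hf Hg (filterlim_mult lf lg)). Qed.

Lemma lim_opp (f : T -> R) (l : R) :
  filterlim f F (locally l) -> filterlim (fun t => - f t) F (locally (- l)).
Proof. intros Hf. exact (filterlim_comp _ _ _ f Ropp _ _ _ Hf (filterlim_opp l)). Qed.

Lemma lim_minus (f g : T -> R) (lf lg : R) :
  filterlim f F (locally lf) -> filterlim g F (locally lg) ->
  filterlim (fun t => f t - g t) F (locally (lf - lg)).
Proof. intros Hf Hg. exact (lim_plus _ _ _ _ Hf (lim_opp _ _ Hg)). Qed.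

Lemma lim_inv (f : T -> R) (l : R) :
  l <> 0 -> filterlim f F (locally l) -> filterlim (fun t => / f t) F (locally (/ l)).
Proof.
intros Hl. apply (lim_comp F Rinv).
exact (continuous_Rinv_comp (fun x => x) l (continuous_id _) Hl).
Qed.

Lemma lim_div (f g : T -> R) (lf lg : R) :
  lg <> 0 -> filterlim f F (locally lf) -> filterlim g F (locally lg) ->
  filterlim (fun t => f t / g t) F (locally (lf / lg)).
Proof. intros Hl Hf Hg. exact (lim_mult _ _ _ _ Hf (lim_inv _ _ Hl Hg)). Qed.

Lemma lim_pow (n : nat) (f : T -> R) (l : R) :
  filterlim f F (locally l) -> filterlim (fun t => f t ^ n) F (locally (l ^ n)).
Proof.
intros Hf. induction n as [|n IH]; simpl.
- apply filterlim_const.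
- now apply lim_mult.
Qed.

Lemma lim_sqrt (f : T -> R) (l : R) :
  filterlim f F (locally l) -> filterlim (fun t => sqrt (f t)) F (locally (sqrt l)).
Proof. apply (lim_comp F sqrt), continuous_sqrt. Qed.

Lemma lim_ln (f : T -> R) (l : R) :
  0 < l -> filterlim f F (locally l) -> filterlim (fun t => ln (f t)) F (locally (ln l)).
Proof. intros Hl. apply (lim_comp F ln), continuous_ln, Hl. Qed.

Lemma lim_lt (f : T -> R) (l c : R) :
  filterlim f F (locally l) -> l < c -> F (fun t => f t < c).
Proof. intros Hf Hl. exact (Hf _ (open_lt c l Hl)). Qed.

Lemma lim_gt (f : T -> R) (l c : R) :
  filterlim f F (locally l) -> c < l -> F (fun t => c < f t).
Proof. intros Hf Hl. exact (Hf _ (open_gt c l Hl)). Qed.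

Lemma lim_glue {V : Type} (G : (V -> Prop) -> Prop) (f g h : T -> V) :
  F (fun t => h t = f t \/ h t = g t) ->
  filterlim f F G -> filterlim g F G -> filterlim h F G.
Proof.
intros Hh Hf Hg P HP.
assert (Hf' : F (fun t => P (f t))) by exact (Hf P HP).
assert (Hg' : F (fun t => P (g t))) by exact (Hg P HP).
unfold filtermap. generalize (filter_and _ _ Hh (filter_and _ _ Hf' Hg')).
apply filter_imp. intros t [[E|E] [H1 H2]]; rewrite E; assumption.
Qed.

End Limits.

Ltac lim :=
  repeat first [ eassumption | solve [apply filterlim_const] | solve [apply filterlim_id]
               | apply lim_plus | apply lim_minus | apply lim_opp | apply lim_mult
               | apply lim_pow | apply lim_sqrt | apply lim_div | apply lim_inv ].

(** * The rate function *)

Lemma le_sqrt2_sq (x : R) : sqrt 2 <= x -> 2 <= x ^ 2.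
Proof.
intros H. assert (Hs := sqrt_pos 2). assert (H2 := sqrt_sqrt 2 ltac:(lra)). nra.
Qed.

Lemma lt_sqrt2_sq (x : R) : sqrt 2 < x -> 2 < x ^ 2.
Proof.
intros H. assert (Hs := sqrt_pos 2). assert (H2 := sqrt_sqrt 2 ltac:(lra)). nra.
Qed.

Lemma continuous_rate (x : R) : continuous (fun z : R => sqrt (z ^ 2 - 2)) x.
Proof. unfold continuous. lim. Qed.

Lemma is_derive_I1 (x : R) : is_derive I1 x (sqrt (x ^ 2 - 2)).
Proof.
apply (is_derive_RInt (fun z => sqrt (z ^ 2 - 2)) I1 (sqrt 2) x).
- apply filter_forall. intros y. apply (@RInt_correct R_CompleteNormedModule).
  apply (@ex_RInt_continuous R_CompleteNormedModule). intros z _. apply continuous_rate.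
- apply continuous_rate.
Qed.

Lemma continuous_I1 (x : R) : continuous I1 x.
Proof. apply (@ex_derive_continuous R_AbsRing R_NormedModule). eexists. apply is_derive_I1. Qed.

Lemma I1_sqrt2 : I1 (sqrt 2) = 0.
Proof. exact (RInt_point (sqrt 2) (fun z => sqrt (z ^ 2 - 2))). Qed.

Lemma I1_mean_value (x y : R) :
  exists c, Rmin x y <= c <= Rmax x y /\ I1 y - I1 x = sqrt (c ^ 2 - 2) * (y - x).
Proof.
apply (MVT_gen I1 x y (fun c => sqrt (c ^ 2 - 2))).
- intros c _. apply is_derive_I1.
- intros c _. apply continuity_pt_filterlim, continuous_I1.
Qed.

(** Convexity of the rate on its domain, as a tangent inequality. *)
Lemma I1_tangent (x y : R) : sqrt 2 <= x -> sqrt 2 <= y ->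
  I1 y - I1 x <= sqrt (y ^ 2 - 2) * (y - x).
Proof.
intros Hx Hy. assert (Hs := sqrt_pos 2).
destruct (I1_mean_value x y) as [c [[Hc1 Hc2] ->]].
destruct (Rle_dec x y) as [Hxy|Hxy].
- rewrite Rmin_left in Hc1 by lra. rewrite Rmax_right in Hc2 by lra.
  apply Rmult_le_compat_r; [lra|]. apply sqrt_le_1_alt. nra.
- rewrite Rmin_right in Hc1 by lra. rewrite Rmax_left in Hc2 by lra.
  assert (sqrt (y ^ 2 - 2) <= sqrt (c ^ 2 - 2)) by (apply sqrt_le_1_alt; nra). nra.
Qed.

Lemma I1_lt (x y : R) : sqrt 2 <= x -> x < y -> I1 x < I1 y.
Proof.
intros Hx Hxy. assert (Hs := sqrt_pos 2).
(* The derivative may vanish at x, but not at the midpoint: the tangent there makes the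
   increase strict on the right half of the interval. *)
assert (H1 := I1_tangent ((x + y) / 2) x ltac:(lra) Hx).
assert (H2 := I1_tangent y ((x + y) / 2) ltac:(lra) ltac:(lra)).
assert (0 <= sqrt (x ^ 2 - 2)) by apply sqrt_pos.
assert (0 < sqrt (((x + y) / 2) ^ 2 - 2)).
{ apply sqrt_lt_R0. assert (H3 := lt_sqrt2_sq ((x + y) / 2) ltac:(lra)). lra. }
nra.
Qed.

Lemma I1_pos (x : R) : sqrt 2 < x -> 0 < I1 x.
Proof. intros Hx. rewrite <- I1_sqrt2. apply I1_lt; lra. Qed.

Lemma sqrt2_lt_2 : sqrt 2 < 2.
Proof. assert (Hs := sqrt_pos 2). assert (H2 := sqrt_sqrt 2 ltac:(lra)). nra. Qed.

Lemma I1_ge (x : R) : 2 <= x -> x - 2 <= I1 x.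
Proof.
intros Hx. assert (Hs := sqrt2_lt_2).
assert (H := I1_tangent x 2 ltac:(lra) ltac:(lra)).
assert (H1 : 1 <= sqrt (2 ^ 2 - 2)) by (rewrite <- sqrt_1; apply sqrt_le_1_alt; lra).
assert (H2 := I1_pos 2 Hs). nra.
Qed.

(** * The saddle point *)

(** For 0 <= r and 1 <= s, the exponential of the t >= 0 such that cosh t + r sinh t = s. *)
Definition saddle_exp (r s : R) : R := (s + sqrt (s ^ 2 - 1 + r ^ 2)) / (1 + r).

(** sqrt 2 cosh t for that t, so that sqrt (saddle^2 - 2) = sqrt 2 sinh t.  Unlike the
    formula obtained by solving for x directly, this one has no singular case at r = 1. *)
Definition saddle (r s : R) : R :=
  sqrt 2 * ((saddle_exp r s + / saddle_exp r s) / 2).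

Lemma saddle_exp_ge1 (r s : R) : 0 <= r -> 1 <= s -> 1 <= saddle_exp r s.
Proof.
intros Hr Hs. unfold saddle_exp.
assert (r <= sqrt (s ^ 2 - 1 + r ^ 2)).
{ rewrite <- (sqrt_pow2 r Hr) at 1. apply sqrt_le_1_alt. nra. }
apply (Rmult_le_reg_r (1 + r)); [lra|]. unfold Rdiv.
rewrite Rmult_assoc, Rinv_l by lra. lra.
Qed.

Lemma saddle_spec (r s : R) : 0 <= r -> 1 <= s ->
  sqrt 2 <= saddle r s /\
  saddle r s + r * sqrt (saddle r s ^ 2 - 2) = sqrt 2 * s.
Proof.
intros Hr Hs. assert (HT := saddle_exp_ge1 r s Hr Hs).
(* The saddle equation as a quadratic equation in exp t. *)
assert (Hq : (1 + r) * saddle_exp r s ^ 2 - 2 * s * saddle_exp r s + (1 - r) = 0).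
{ unfold saddle_exp. set (q := sqrt _).
  assert (Hq : q ^ 2 = s ^ 2 - 1 + r ^ 2) by (apply pow2_sqrt; nra).
  transitivity ((q ^ 2 - (s ^ 2 - 1 + r ^ 2)) / (1 + r)); [field; lra|].
  rewrite Hq. field. lra. }
unfold saddle. set (T := saddle_exp r s) in *.
assert (H2 := pow2_sqrt 2 ltac:(lra)). assert (H0 := sqrt_pos 2).
assert (HI : 0 < / T <= 1).
{ split; [apply Rinv_0_lt_compat; lra|]. rewrite <- Rinv_1.
  apply Rinv_le_contravar; lra. }
assert (HTI : T * / T = 1) by (apply Rinv_r; lra).
split.
- assert (1 <= (T + / T) / 2) by nra. nra.
- replace (sqrt ((sqrt 2 * ((T + / T) / 2)) ^ 2 - 2)) with (sqrt 2 * ((T - / T) / 2)).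
  + replace s with (((1 + r) * T + (1 - r) / T) / 2); [unfold Rdiv; ring|].
    apply (Rmult_eq_reg_r T); [|lra]. field_simplify; [|lra]. nra.
  + symmetry. replace (_ - 2) with ((sqrt 2 * ((T - / T) / 2)) ^ 2).
    * apply sqrt_pow2. apply Rmult_le_pos; lra.
    * rewrite !Rpow_mult_distr, H2. field. lra.
Qed.

Lemma saddle_unique (r x y : R) : 0 <= r -> sqrt 2 <= x -> sqrt 2 <= y ->
  x + r * sqrt (x ^ 2 - 2) = y + r * sqrt (y ^ 2 - 2) -> x = y.
Proof.
assert (W : forall x y, 0 <= r -> sqrt 2 <= x -> x < y ->
  x + r * sqrt (x ^ 2 - 2) < y + r * sqrt (y ^ 2 - 2)).
{ intros x' y' Hr Hx Hxy. assert (H0 := sqrt_pos 2).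
  assert (sqrt (x' ^ 2 - 2) <= sqrt (y' ^ 2 - 2)) by (apply sqrt_le_1_alt; nra). nra. }
intros Hr Hx Hy E. destruct (Rtotal_order x y) as [H|[H|H]]; [|exact H|].
- assert (H' := W x y Hr Hx H). lra.
- assert (H' := W y x Hr Hy H). lra.
Qed.

Lemma saddle_lt (r s t : R) : 0 <= r -> 1 <= s -> s < t -> saddle r s < saddle r t.
Proof.
intros Hr Hs Hst.
destruct (saddle_spec r s Hr Hs) as [H1 E1].
destruct (saddle_spec r t Hr ltac:(lra)) as [H2 E2].
assert (H0 : 0 < sqrt 2) by (apply sqrt_lt_R0; lra).
apply Rnot_le_lt. intros H.
assert (sqrt (saddle r t ^ 2 - 2) <= sqrt (saddle r s ^ 2 - 2))
  by (apply sqrt_le_1_alt; nra). nra.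
Qed.

Lemma saddle_1 (r : R) : 0 <= r -> saddle r 1 = sqrt 2.
Proof.
intros Hr. destruct (saddle_spec r 1 Hr ltac:(lra)) as [H1 E1].
apply (saddle_unique r); auto; [lra|]. rewrite E1, pow2_sqrt by lra.
replace (2 - 2) with 0 by ring. rewrite sqrt_0. ring.
Qed.

Lemma saddle_gt (r s : R) : 0 <= r -> 1 < s -> sqrt 2 < saddle r s.
Proof. intros Hr Hs. rewrite <- (saddle_1 r Hr). apply saddle_lt; lra. Qed.

Lemma lim_saddle {T : Type} {F : (T -> Prop) -> Prop} {FF : Filter F}
  (r s : T -> R) (r0 s0 : R) : 0 <= r0 -> 1 <= s0 ->
  filterlim r F (locally r0) -> filterlim s F (locally s0) ->
  filterlim (fun t => saddle (r t) (s t)) F (locally (saddle r0 s0)).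
Proof.
intros Hr0 Hs0 Hr Hs.
assert (HT := saddle_exp_ge1 r0 s0 Hr0 Hs0).
assert (L : filterlim (fun t => saddle_exp (r t) (s t)) F (locally (saddle_exp r0 s0))).
{ unfold saddle_exp. lim. lra. }
unfold saddle. lim; lra.
Qed.

Lemma ex_derive_saddle (r s : R) : 0 <= r -> 1 < s -> ex_derive (saddle r) s.
Proof.
intros Hr Hs. assert (HT := saddle_exp_ge1 r s Hr ltac:(lra)).
assert (Hq : 0 < s ^ 2 - 1 + r ^ 2) by nra.
unfold saddle, saddle_exp in *. auto_derive.
change (s * (s * 1) + - (1) + r * (r * 1)) with (s ^ 2 - 1 + r ^ 2).
repeat split; trivial. fold (Rdiv (s + sqrt (s ^ 2 - 1 + r ^ 2)) (1 + r)). lra.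
Qed.
(** * The branch below the threshold *)

(** The constraints satisfied by a = nu' and b = nu'': the mean of the exponents is at
    least 2 and their variance is nonnegative. *)
Definition moments (a b : R) : Prop := 2 <= a /\ 0 <= b + a - a ^ 2.

Definition threshold (a b : R) : R := (b - a + a ^ 2) / (a * sqrt b).

(** In the saddle equation, k enters through K = k + 1. *)
Definition saddle_point (a b K u : R) : R :=
  saddle (K * (b + a - a ^ 2) / (b - a + a ^ 2)) (- u / threshold a b).

(** The value of 1/2 log (b / a) + F(-x, u) - K I_1(x) after elimination of u by the
    saddle equation; it is regular at b + a - a^2 = 0. *)
Definition saddle_value (a b K x : R) : R :=
  1 / 2 * ln (b / a)
  - ((b - a) * ((b - a + a ^ 2) * x ^ 2
                + 2 * (K * (b + a - a ^ 2)) * x * sqrt (x ^ 2 - 2))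
     + (b + a) * K ^ 2 * (b + a - a ^ 2) * (x ^ 2 - 2)) / (4 * a ^ 2 * b)
  - K * I1 x.

Definition lower_branch (a b K u : R) : R := saddle_value a b K (saddle_point a b K u).

Lemma moments_le (a b : R) : moments a b -> 2 <= a /\ a <= b /\ 0 < b - a + a ^ 2.
Proof. unfold moments. intros [H1 H2]. repeat split; nra. Qed.

Lemma threshold_pos (a b : R) : moments a b -> 0 < threshold a b.
Proof.
intros H. destruct (moments_le a b H) as (H1 & H2 & H3).
apply Rdiv_lt_0_compat; [lra|]. apply Rmult_lt_0_compat; [|apply sqrt_lt_R0]; lra.
Qed.

Lemma coupling_ge0 (a b K : R) : moments a b -> 0 <= K ->
  0 <= K * (b + a - a ^ 2) / (b - a + a ^ 2).
Proof.
intros H HK. destruct (moments_le a b H) as (H1 & H2 & H3). destruct H as [_ H].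
apply Rmult_le_pos; [now apply Rmult_le_pos|]. now apply Rlt_le, Rinv_0_lt_compat.
Qed.

Lemma level_le (t u v : R) : 0 < t -> u <= v -> - v / t <= - u / t.
Proof.
intros Ht H. apply Rmult_le_compat_r; [now apply Rlt_le, Rinv_0_lt_compat|lra].
Qed.

Lemma level_lt (t u v : R) : 0 < t -> u < v -> - v / t < - u / t.
Proof. intros Ht H. apply Rmult_lt_compat_r; [now apply Rinv_0_lt_compat|lra]. Qed.

Lemma level_1 (t : R) : 0 < t -> - - t / t = 1.
Proof. intros Ht. field. lra. Qed.

Lemma saddle_point_spec (a b K u : R) : moments a b -> 0 <= K -> u <= - threshold a b ->
  sqrt 2 <= saddle_point a b K u /\
  saddle_point a b K u
  + K * (b + a - a ^ 2) / (b - a + a ^ 2) * sqrt (saddle_point a b K u ^ 2 - 2)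
  = sqrt 2 * (- u / threshold a b).
Proof.
intros H HK Hu. assert (Ht := threshold_pos a b H). apply saddle_spec.
- now apply coupling_ge0.
- rewrite <- (level_1 _ Ht). now apply level_le.
Qed.

Lemma saddle_point_threshold (a b K : R) : moments a b -> 0 <= K ->
  saddle_point a b K (- threshold a b) = sqrt 2.
Proof.
intros H HK. unfold saddle_point. rewrite level_1 by now apply threshold_pos.
now apply saddle_1, coupling_ge0.
Qed.

Lemma saddle_point_gt (a b K u : R) : moments a b -> 0 <= K -> u < - threshold a b ->
  sqrt 2 < saddle_point a b K u.
Proof.
intros H HK Hu. assert (Ht := threshold_pos a b H). apply saddle_gt.
- now apply coupling_ge0.
- rewrite <- (level_1 _ Ht). now apply level_lt.
Qed.

Lemma saddle_value_lt (a b K x y : R) : moments a b -> 0 < K ->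
  sqrt 2 <= x -> x < y -> saddle_value a b K y < saddle_value a b K x.
Proof.
intros H HK Hx Hxy. destruct (moments_le a b H) as (H1 & H2 & H3).
destruct H as [_ H]. unfold saddle_value.
assert (HI := I1_lt x y Hx Hxy). assert (H0 := sqrt_pos 2).
set (A := b + a - a ^ 2) in *. set (D := b - a + a ^ 2) in *.
assert (Hsq : x ^ 2 <= y ^ 2) by nra.
assert (Hh : x * sqrt (x ^ 2 - 2) <= y * sqrt (y ^ 2 - 2)).
{ apply Rmult_le_compat; try lra; [apply sqrt_pos|apply sqrt_le_1_alt; lra]. }
assert (0 <= K * A) by (apply Rmult_le_pos; lra).
assert (0 <= (b + a) * K ^ 2 * A).
{ repeat apply Rmult_le_pos; try lra. }
match goal with |- _ - ?P / ?c - _ < _ - ?Q / _ - _ =>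
  assert (HQ : Q <= P); [|assert (Hdiv : Q / c <= P / c)] end.
- apply Rplus_le_compat; [|apply Rmult_le_compat_l; lra].
  apply Rmult_le_compat_l; [lra|]. apply Rplus_le_compat.
  + apply Rmult_le_compat_l; lra.
  + rewrite !(Rmult_assoc (2 * (K * A))). apply Rmult_le_compat_l; lra.
- apply Rmult_le_compat_r; [|exact HQ]. apply Rlt_le, Rinv_0_lt_compat. nra.
- assert (K * I1 x < K * I1 y) by (apply Rmult_lt_compat_l; lra). lra.
Qed.

Lemma lower_branch_lt (a b K u v : R) : moments a b -> 0 < K ->
  u < v -> v <= - threshold a b -> lower_branch a b K u < lower_branch a b K v.
Proof.
intros H HK Huv Hv. assert (Ht := threshold_pos a b H).
apply saddle_value_lt; trivial.
- apply saddle_point_spec; trivial. lra.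
- apply saddle_lt; [apply coupling_ge0; trivial; lra| |now apply level_lt].
  rewrite <- (level_1 _ Ht). now apply level_le.
Qed.

Lemma lower_branch_threshold (a b K : R) : moments a b -> 0 <= K ->
  lower_branch a b K (- threshold a b)
  = 1 / 2 * ln (b / a) - (b - a) * (b - a + a ^ 2) / (2 * a ^ 2 * b).
Proof.
intros H HK. destruct (moments_le a b H) as (H1 & H2 & H3).
unfold lower_branch. rewrite saddle_point_threshold by trivial. unfold saddle_value.
rewrite I1_sqrt2, pow2_sqrt by lra. replace (2 - 2) with 0 by ring. rewrite sqrt_0.
field. lra.
Qed.

Lemma lower_branch_neg (a b K : R) : moments a b -> 1 <= K ->
  exists u, u < - threshold a b /\ lower_branch a b K u < 0.
Proof.
intros H HK. destruct (moments_le a b H) as (H1 & H2 & H3).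
assert (Ht := threshold_pos a b H). assert (H0 := sqrt_pos 2).
assert (Hr := coupling_ge0 a b K H ltac:(lra)).
assert (Hs0 := sqrt2_lt_2). assert (Hs1 : 0 < sqrt 2) by (apply sqrt_lt_R0; lra).
set (x := 3 + Rabs (ln (b / a))).
assert (Hx : 3 <= x) by (unfold x; assert (HR := Rabs_pos (ln (b / a))); lra).
(* The level is read off from the saddle equation at the prescribed x. *)
set (r := K * (b + a - a ^ 2) / (b - a + a ^ 2)) in *.
set (s := (x + r * sqrt (x ^ 2 - 2)) / sqrt 2).
assert (Hss : sqrt 2 * s = x + r * sqrt (x ^ 2 - 2)) by (unfold s; field; lra).
assert (Hs : 1 < s).
{ assert (0 <= r * sqrt (x ^ 2 - 2)) by (apply Rmult_le_pos; [trivial|apply sqrt_pos]).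
  nra. }
exists (- (threshold a b * s)). split; [nra|].
unfold lower_branch, saddle_point. fold r.
replace (- - (threshold a b * s) / threshold a b) with s by (field; lra).
assert (E : saddle r s = x).
{ destruct (saddle_spec r s Hr ltac:(lra)) as [E1 E2].
  apply (saddle_unique r); trivial; lra. }
rewrite E. unfold saddle_value.
assert (HI := I1_ge x ltac:(lra)).
assert (HA : ln (b / a) <= Rabs (ln (b / a))) by apply Rle_abs.
assert (x - 2 <= K * I1 x) by nra.
match goal with |- _ - ?P / ?c - _ < _ => assert (HP : 0 <= P / c) end.
{ destruct H as [_ H]. apply Rmult_le_pos; [|apply Rlt_le, Rinv_0_lt_compat; nra].
  assert (0 <= sqrt (x ^ 2 - 2)) by apply sqrt_pos.
  assert (0 <= x ^ 2 - 2) by nra.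
  assert (0 <= x ^ 2) by nra.
  apply Rplus_le_le_0_compat; repeat apply Rmult_le_pos; try lra.
  apply Rplus_le_le_0_compat; repeat apply Rmult_le_pos; lra. }
assert (HR := Rabs_pos (ln (b / a))). unfold x in *. lra.
Qed.

(** Joint continuity, along an arbitrary filter so that it applies both to the continuity
    in u for a fixed mixture and to the limit along mixtures for a fixed u. *)
Lemma lim_lower_branch {T : Type} {F : (T -> Prop) -> Prop} {FF : Filter F}
  (a b u : T -> R) (K a0 b0 u0 : R) :
  moments a0 b0 -> 0 <= K -> u0 <= - threshold a0 b0 ->
  filterlim a F (locally a0) -> filterlim b F (locally b0) ->
  filterlim u F (locally u0) ->
  filterlim (fun t => lower_branch (a t) (b t) K (u t)) F
    (locally (lower_branch a0 b0 K u0)).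
Proof.
intros H HK Hu0 Ha Hb Hu. destruct (moments_le a0 b0 H) as (H1 & H2 & H3).
assert (Ht := threshold_pos a0 b0 H).
assert (Hsb : 0 < sqrt b0) by (apply sqrt_lt_R0; lra).
assert (Hth : filterlim (fun t => threshold (a t) (b t)) F (locally (threshold a0 b0))).
{ unfold threshold. lim. nra. }
assert (Hx : filterlim (fun t => saddle_point (a t) (b t) K (u t)) F
               (locally (saddle_point a0 b0 K u0))).
{ apply lim_saddle.
  - now apply coupling_ge0.
  - rewrite <- (level_1 _ Ht). now apply level_le.
  - lim. lra.
  - lim. lra. }
unfold lower_branch, saddle_value.
assert (HI : filterlim (fun t => I1 (saddle_point (a t) (b t) K (u t))) F
               (locally (I1 (saddle_point a0 b0 K u0)))).
{ exact (lim_comp F I1 _ _ (continuous_I1 _) Hx). }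
assert (HL : filterlim (fun t => ln (b t / a t)) F (locally (ln (b0 / a0)))).
{ apply lim_ln; [apply Rdiv_lt_0_compat; lra|]. lim. lra. }
lim; nra.
Qed.

Lemma continuous_lower_branch (a b K u : R) : moments a b -> 0 <= K ->
  u <= - threshold a b -> continuous (lower_branch a b K) u.
Proof.
intros H HK Hu. apply (lim_lower_branch (fun _ => a) (fun _ => b)); trivial; lim.
Qed.

Lemma ex_derive_saddle_value (a b K x : R) : sqrt 2 < x -> 
  ex_derive (saddle_value a b K) x.
Proof.
intros Hx. assert (H2 := lt_sqrt2_sq x Hx).
unfold saddle_value. auto_derive. repeat split; trivial; try lra.
eexists. apply is_derive_I1.
Qed.

Lemma ex_derive_lower_branch (a b K u : R) : moments a b -> 0 <= K ->
  u < - threshold a b -> ex_derive (lower_branch a b K) u.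
Proof.
intros H HK Hu. assert (Ht := threshold_pos a b H).
apply (ex_derive_comp (saddle_value a b K) (saddle_point a b K)).
- now apply ex_derive_saddle_value, saddle_point_gt.
- apply (ex_derive_comp (saddle (K * (b + a - a ^ 2) / (b - a + a ^ 2)))
          (fun u => - u / threshold a b)).
  + apply ex_derive_saddle; [now apply coupling_ge0|].
    rewrite <- (level_1 _ Ht). now apply level_lt.
  + auto_derive. lra.
Qed.

Lemma unique_zero (f : R -> R) (m u0 : R) :
  (forall u v, u < v -> v <= m -> f u < f v) ->
  (forall u, u <= m -> continuous f u) -> u0 < m -> f u0 < 0 -> 0 < f m ->
  exists z, z < m /\ forall u, u <= m -> (f u = 0 <-> u = z).
Proof.
intros Hf Cf Hu0 H0 Hm.
destruct (IVT_Rbar_incr f u0 m (f u0) (f m) 0) as (z & Hz1 & Hz2 & Hz3).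
- apply is_lim_continuity, continuity_pt_filterlim, Cf. lra.
- apply is_lim_continuity, continuity_pt_filterlim, Cf. lra.
- intros x _ Hx. simpl in Hx. apply continuity_pt_filterlim, Cf. lra.
- exact Hu0.
- split; assumption.
- simpl in Hz1, Hz2. exists z. split; [exact Hz2|]. intros u Hu. split; [|now intros ->].
  intros E. destruct (Rtotal_order u z) as [L|[L|L]]; [|exact L|].
  + assert (H := Hf u z L ltac:(lra)). lra.
  + assert (H := Hf z u L Hu). lra.
Qed.
(** * Moments of a mixture *)

Lemma term_le_series (s : nat -> R) (l : R) (n : nat) :
  (forall i, 0 <= s i) -> is_series s l -> s n <= l.
Proof.
intros Hs H. apply Rle_trans with (sum_n s n).
- destruct n; [rewrite sum_O; lra|]. rewrite sum_Sn. unfold plus; simpl.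
  assert (0 <= sum_n s n); [|lra].
  rewrite sum_n_Reals. now apply cond_pos_sum.
- apply (is_lim_seq_incr_compare (sum_n s) l H). intros i.
  rewrite sum_Sn. unfold plus; simpl. assert (Hi := Hs (S i)). lra.
Qed.

(** beta_p^2 4^p is the square of the general term 2^p beta_p of a convergent series,
    hence bounded. *)
Lemma mixture_radius (beta : nat -> R) : mixture beta ->
  Rbar_lt (Rabs 1) (CV_radius (fun p => beta p ^ 2)).
Proof.
intros H. rewrite Rabs_R1. apply Rbar_lt_le_trans with 4; [simpl; lra|].
apply CV_radius_bounded.
destruct (mixture_ex_series _ H) as [M HM]. exists (M ^ 2). intros n.
assert (Hn := term_le_series _ _ n
  (fun i => Rmult_le_pos _ _ (pow_le 2 i ltac:(lra)) (mixture_ge0 _ H i)) HM).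
assert (H0 := Rmult_le_pos _ _ (pow_le 2 n ltac:(lra)) (mixture_ge0 _ H n)).
simpl in Hn, H0.
replace (beta n ^ 2 * 4 ^ n) with ((2 ^ n * beta n) ^ 2).
- rewrite Rabs_pos_eq by apply pow2_ge_0. apply pow_incr. lra.
- replace 4 with (2 * 2) by ring. rewrite (Rpow_mult_distr 2 2). ring.
Qed.

Lemma pseries_at_1 (a : nat -> R) : ex_pseries a 1 -> is_series a (PSeries a 1).
Proof.
intros H. apply PSeries_correct in H. revert H. apply is_series_ext.
intros n. rewrite pow_n_pow, pow1. unfold scal; simpl. unfold mult; simpl. ring.
Qed.

Lemma is_series_nu1 (beta : nat -> R) : mixture beta ->
  is_series (fun p => INR p * beta p ^ 2) (nu1 beta).
Proof.
intros H. assert (HR := mixture_radius beta H). unfold nu1, nu.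
rewrite Derive_PSeries by exact HR.
apply is_series_decr_1.
replace (plus _ _) with (PSeries (PS_derive (fun p => beta p ^ 2)) 1).
- exact (pseries_at_1 _ (ex_pseries_derive _ _ HR)).
- unfold plus, opp; simpl. ring.
Qed.

Lemma is_series_nu2 (beta : nat -> R) : mixture beta ->
  is_series (fun p => INR p * (INR p - 1) * beta p ^ 2) (nu2 beta).
Proof.
intros H. assert (HR := mixture_radius beta H). unfold nu2, nu.
rewrite (Derive_n_PSeries 2) by exact HR.
apply is_series_decr_1, is_series_decr_1.
replace (plus _ _)
  with (PSeries (PS_derive (PS_derive (fun p => beta p ^ 2))) 1).
- apply (is_series_ext (PS_derive (PS_derive (fun p => beta p ^ 2)))).
  + intros n. unfold PS_derive. rewrite (S_INR (S n)). match goal with |- ?x = ?y => change (@eq R x y) end. ring.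
  + apply pseries_at_1, (ex_pseries_derive (PS_derive _)). now rewrite CV_radius_derive.
- transitivity (PSeries (PS_derive_n 2 (fun p => beta p ^ 2)) 1).
  + apply PSeries_ext. intros n. unfold PS_derive, PS_derive_n.
    replace (n + 2)%nat with (S (S n)) by ring. rewrite !fact_simpl, !mult_INR.
    field. apply INR_fact_neq_0.
  + unfold plus, opp; simpl. ring.
Qed.

(** Its terms are nonnegative, so keeping a single one of them bounds the corresponding
    weight; c is chosen according to the exponent of interest. *)
Lemma is_series_square_dist (beta : nat -> R) (c : R) : mixture beta ->
  is_series (fun p => beta p ^ 2 * (INR p - c) ^ 2) (alpha2 beta + (nu1 beta - c) ^ 2).
Proof.
intros H.
assert (H2 := is_series_plus _ _ _ _ (is_series_nu2 _ H)
  (is_series_plus _ _ _ _ (is_series_scal (1 - 2 * c) _ _ (is_series_nu1 _ H))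
    (is_series_scal (c ^ 2) _ _ (mixture_series _ H)))).
replace (alpha2 beta + (nu1 beta - c) ^ 2) with
  (plus (nu2 beta) (plus (scal (1 - 2 * c) (nu1 beta)) (scal (c ^ 2) 1))).
- revert H2. apply is_series_ext. intros n.
  unfold plus, scal; simpl; unfold mult; simpl. ring.
- unfold alpha2, plus, scal; simpl; unfold mult; simpl. ring.
Qed.

Lemma mixture_moments (beta : nat -> R) : mixture beta -> moments (nu1 beta) (nu2 beta).
Proof.
intros H. split.
- assert (HS : is_series (fun p => (INR p - 2) * beta p ^ 2) (nu1 beta - 2)).
  { assert (H2 := is_series_minus _ _ _ _ (is_series_nu1 _ H)
      (is_series_scal 2 _ _ (mixture_series _ H))).
    replace (nu1 beta - 2) with (minus (nu1 beta) (scal 2 1)).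
    - revert H2. apply is_series_ext. intros n.
      unfold minus, plus, opp, scal; simpl; unfold mult; simpl. ring.
    - unfold minus, plus, opp, scal; simpl; unfold mult; simpl. ring. }
  apply (term_le_series _ _ 0) in HS.
  + simpl in HS. rewrite (mixture_0 _ H) in HS. lra.
  + intros [|[|n]].
    * rewrite (mixture_0 _ H). simpl. lra.
    * rewrite (mixture_1 _ H). simpl. lra.
    * apply Rmult_le_pos; [|apply pow2_ge_0]. rewrite !S_INR.
      assert (Hn := pos_INR n). lra.
- apply (is_series_square_dist _ (nu1 beta)), (term_le_series _ _ 0) in H.
  + assert (H0 := pow2_ge_0 (beta 0%nat)). assert (H1 := pow2_ge_0 (INR 0 - nu1 beta)).
    unfold alpha2 in H. nra.
  + intros n. apply Rmult_le_pos; apply pow2_ge_0.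
Qed.

Lemma weight_le_1 (beta : nat -> R) (p : nat) : mixture beta -> beta p ^ 2 <= 1.
Proof.
intros H. apply (term_le_series (fun p => beta p ^ 2)); [|apply (mixture_series _ H)].
intros n. apply pow2_ge_0.
Qed.

(** A weight close to 1 at p pins the mean to p at a scale smaller than the
    standard deviation: the part of the mass away from p both shifts the mean and
    creates the variance, and Cauchy-Schwarz compares the two effects. *)
Lemma mean_deviation (beta : nat -> R) (p : nat) : mixture beta ->
  beta p ^ 2 * (nu1 beta - INR p) ^ 2 <= (1 - beta p ^ 2) * alpha2 beta.
Proof.
intros H. set (q := beta p ^ 2). set (d := INR p - nu1 beta).
assert (Hq : 0 <= q <= 1) by (split; [apply pow2_ge_0|now apply weight_le_1]).
(* The term of index p of the second moment about the point nu' - t. *)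
assert (W : forall t, q * (d + t) ^ 2 <= alpha2 beta + t ^ 2).
{ intros t. assert (HS := is_series_square_dist beta (nu1 beta - t) H).
  apply (term_le_series _ _ p) in HS.
  - unfold q, d. replace (INR p - nu1 beta + t) with (INR p - (nu1 beta - t)) by ring.
    replace (t ^ 2) with ((nu1 beta - (nu1 beta - t)) ^ 2) by ring. exact HS.
  - intros n. apply Rmult_le_pos; apply pow2_ge_0. }
replace ((nu1 beta - INR p) ^ 2) with (d ^ 2) by (unfold d; ring).
destruct (Req_dec q 1) as [E|E].
- rewrite E in *.
  assert (Hd : d = 0).
  { apply NNPP. intros Hd. assert (Wt := W ((alpha2 beta + 1) / (2 * d))).
    assert (E1 : 1 * (d + (alpha2 beta + 1) / (2 * d)) ^ 2 =
      d ^ 2 + (alpha2 beta + 1) + ((alpha2 beta + 1) / (2 * d)) ^ 2) by (field; exact Hd).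
    assert (H2 := pow2_ge_0 d). lra. }
  rewrite Hd. lra.
- (* The choice of t that makes the inequality optimal. *)
  assert (Wt := W (q * d / (1 - q))).
  assert (E1 : q * (d + q * d / (1 - q)) ^ 2 - (q * d / (1 - q)) ^ 2
               = q * d ^ 2 / (1 - q)) by (field; lra).
  assert (E2 : q * d ^ 2 / (1 - q) <= alpha2 beta) by lra.
  apply (Rmult_le_compat_l (1 - q)) in E2; [|lra].
  replace (q * d ^ 2) with ((1 - q) * (q * d ^ 2 / (1 - q))) by (field; lra).
  exact E2.
Qed.

(** Every term of the second moment about the mean vanishes, which leaves a single
    exponent. *)
Lemma pure_mixture (beta : nat -> R) : mixture beta -> alpha2 beta = 0 ->
  exists p, beta p = 1 /\ nu1 beta = INR p.
Proof.
intros H HA.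
assert (Hn : forall n, beta n <> 0 -> nu1 beta = INR n).
{ intros n Hn. assert (HS := is_series_square_dist beta (nu1 beta) H).
  apply (term_le_series _ _ n) in HS; [|intros; apply Rmult_le_pos; apply pow2_ge_0].
  rewrite HA in HS. assert (H0 : 0 < beta n ^ 2) by now apply pow2_gt_0.
  apply NNPP. intros E.
  assert (H1 : 0 < (INR n - nu1 beta) ^ 2) by (apply pow2_gt_0; lra). nra. }
assert (Hex : exists p, beta p <> 0).
{ apply NNPP. intros Hno. assert (HS := mixture_series _ H).
  assert (E := is_series_scal 0 _ _ HS).
  apply (is_series_ext _ (fun p => beta p ^ 2)) in E.
  - apply is_series_unique in HS, E. rewrite HS in E.
    unfold scal in E; simpl in E; unfold mult in E; simpl in E. lra.
  - intros p. assert (Hp : beta p = 0) by (apply NNPP; intros Hp; apply Hno; now exists p).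
    rewrite Hp. unfold scal; simpl; unfold mult; simpl. ring. }
destruct Hex as [p Hp]. exists p. split; [|now apply Hn].
assert (Hone : forall n, n <> p -> beta n = 0).
{ intros n Hnp. apply NNPP. intros Hb. apply Hnp, INR_eq.
  now rewrite <- (Hn n Hb), (Hn p Hp). }
assert (Hsum : forall n,
  sum_f_R0 (fun i => beta i ^ 2) n = if le_dec p n then beta p ^ 2 else 0).
{ induction n as [|n IH].
  - simpl sum_f_R0. destruct (le_dec p 0) as [L|L].
    + now replace p with 0%nat by lia.
    + rewrite (Hone 0%nat) by lia. ring.
  - rewrite tech5, IH. destruct (le_dec p n) as [L|L], (le_dec p (S n)) as [L'|L']; try lia.
    + rewrite (Hone (S n)) by lia. ring.
    + replace p with (S n) by lia. ring.
    + rewrite (Hone (S n)) by lia. ring. }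
assert (E : is_lim_seq (sum_n (fun i => beta i ^ 2)) (beta p ^ 2)).
{ apply (is_lim_seq_ext_loc (fun _ => beta p ^ 2)); [|apply is_lim_seq_const].
  exists p. intros n L. rewrite sum_n_Reals, Hsum. now destruct (le_dec p n). }
assert (E1 := is_lim_seq_unique _ _ E).
assert (E2 : Lim_seq (sum_n (fun i => beta i ^ 2)) = 1)
  by exact (is_lim_seq_unique _ 1 (mixture_series _ H)).
rewrite E1 in E2. injection E2 as E2. assert (H0 := mixture_ge0 _ H p). nra.
Qed.
(** * The complexity function when alpha does not vanish *)

Lemma E_inf_threshold (beta : nat -> R) : E_inf beta = threshold (nu1 beta) (nu2 beta).
Proof. unfold E_inf, threshold, alpha2. f_equal. ring. Qed.

Lemma E'_inf_pos (beta : nat -> R) : mixture beta -> 0 < E'_inf beta.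
Proof.
intros H. destruct (moments_le _ _ (mixture_moments _ H)) as (H1 & H2 & H3).
unfold E'_inf. apply Rdiv_lt_0_compat; [|lra].
apply Rmult_lt_0_compat; [lra|apply sqrt_lt_R0; lra].
Qed.

Lemma E_inf_minus_E'_inf (beta : nat -> R) : mixture beta ->
  E_inf beta - E'_inf beta
  = (nu2 beta - nu1 beta) * alpha2 beta
    / (nu1 beta * sqrt (nu2 beta) * (nu1 beta + nu2 beta)).
Proof.
intros H. destruct (moments_le _ _ (mixture_moments _ H)) as (H1 & H2 & _).
unfold E_inf, E'_inf, alpha2. set (a := nu1 beta) in *. set (b := nu2 beta) in *.
assert (Hc : 0 < sqrt b) by (apply sqrt_lt_R0; lra).
assert (Hcb : b = sqrt b ^ 2) by (rewrite pow2_sqrt; lra).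
set (c := sqrt b) in *. clearbody a b c. subst b. field. lra.
Qed.

Lemma Sigma_pos (beta : nat -> R) : mixture beta -> nu1 beta < nu2 beta -> 0 < Sigma beta.
Proof.
intros H Hlt. destruct (moments_le _ _ (mixture_moments _ H)) as (H1 & _ & _).
(* Sigma is g (nu'' / nu'), with g 1 = 0 and g increasing on r > 1. *)
set (g := fun r : R => 1 / 2 * ln r - (r - 1) / (r + 1)).
assert (Hr : 1 < nu2 beta / nu1 beta).
{ apply (Rmult_lt_reg_r (nu1 beta)); [lra|]. unfold Rdiv.
  rewrite Rmult_assoc, Rinv_l by lra. lra. }
replace (Sigma beta) with (g (nu2 beta / nu1 beta)).
- destruct (MVT_cor2 g (fun r => (r - 1) ^ 2 / (2 * r * (r + 1) ^ 2)) 1 _ Hr)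
    as (c & E & Hc).
  + intros c Hc. apply is_derive_Reals. unfold g. auto_derive; [lra|]. field. lra.
  + replace (g 1) with 0 in E by (unfold g; rewrite ln_1; field).
    rewrite Rminus_0_r in E. rewrite E.
    apply Rmult_lt_0_compat; [|lra]. apply Rdiv_lt_0_compat; [apply pow_lt; lra|].
    apply Rmult_lt_0_compat; [lra|apply pow_lt; lra].
- unfold g, Sigma. f_equal. field. lra.
Qed.

(** The square is taken of a quotient by alpha: in the limit alpha -> 0 what matters
    is the distance of u to the vertex in units of alpha. *)
Definition upper_branch (beta : nat -> R) (u : R) : R :=
  Sigma beta
  - (nu1 beta + nu2 beta) / 2 * ((u + E'_inf beta) / sqrt (alpha2 beta)) ^ 2.

Lemma continuous_upper_branch (beta : nat -> R) (u : R) : continuous (upper_branch beta) u.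
Proof.
unfold upper_branch, Rdiv. apply (@ex_derive_continuous R_AbsRing R_NormedModule).
now auto_derive.
Qed.

Section PositiveAlpha.
Variable beta : nat -> R.
Hypothesis Hmix : mixture beta.
Hypothesis HA : 0 < alpha2 beta.
Let a := nu1 beta.
Let b := nu2 beta.

Lemma nu1_lt_nu2 : nu1 beta < nu2 beta.
Proof.
destruct (moments_le _ _ (mixture_moments _ Hmix)) as (H1 & _ & _).
unfold alpha2 in HA. nra.
Qed.

Lemma E'_inf_lt_E_inf : E'_inf beta < E_inf beta.
Proof.
destruct (moments_le _ _ (mixture_moments _ Hmix)) as (H1 & _ & _).
assert (H2 := nu1_lt_nu2).
assert (0 < E_inf beta - E'_inf beta); [|lra].
rewrite E_inf_minus_E'_inf by exact Hmix.
apply Rdiv_lt_0_compat; [nra|]. apply Rmult_lt_0_compat; [|lra].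
apply Rmult_lt_0_compat; [|apply sqrt_lt_R0]; lra.
Qed.

Lemma upper_branchE (u : R) :
  1 / 2 * ln (nu2 beta / nu1 beta) + F beta (- sqrt 2) u = upper_branch beta u.
Proof.
destruct (moments_le _ _ (mixture_moments _ Hmix)) as (H1 & H2 & _).
unfold upper_branch, Sigma, F, E'_inf.
assert (Hs2 := pow2_sqrt 2 ltac:(lra)). assert (HsA := pow2_sqrt (alpha2 beta) ltac:(lra)).
assert (HsA0 : 0 < sqrt (alpha2 beta)) by (apply sqrt_lt_R0; lra).
assert (Hsb := pow2_sqrt (nu2 beta) ltac:(lra)).
match goal with |- _ = ?l - ?m - ?n => replace (l - m - n) with (l + (- m - n)) by ring end.
f_equal.
replace (((u + _) / sqrt (alpha2 beta)) ^ 2) with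
  ((u + 2 * nu1 beta * sqrt (nu2 beta) / (nu1 beta + nu2 beta)) ^ 2 / alpha2 beta)
  by (rewrite <- HsA at 1; field; lra).
set (A := alpha2 beta) in *.
transitivity (1 / 2 * (- ((nu2 beta + nu1 beta) / A) * u ^ 2
  - 2 * sqrt 2 ^ 2 * sqrt (nu2 beta) * nu1 beta / A * u
  - (nu2 beta - nu1 beta + nu1 beta ^ 2) / A * sqrt 2 ^ 2)); [field; lra|].
rewrite Hs2.
assert (HAE : A = nu2 beta + nu1 beta - nu1 beta ^ 2) by reflexivity.
set (a' := nu1 beta) in *. set (c := sqrt (nu2 beta)) in *.
set (b' := nu2 beta) in *. clearbody A a' b' c. subst b'. subst A. field. lra.
Qed.

(** On the saddle curve the level u is a linear function of the pair
    (x, sqrt (x^2 - 2)); eliminating it cancels the factor 1 / alpha^2 of F, which is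
    why the value has a limit as alpha tends to 0. *)
Lemma saddle_valueE (K x u : R) : sqrt 2 <= x ->
  x + K * alpha2 beta / (b - a + a ^ 2) * sqrt (x ^ 2 - 2)
  = sqrt 2 * (- u / threshold a b) ->
  1 / 2 * ln (b / a) + F beta (- x) u - K * I1 x = saddle_value a b K x.
Proof.
intros Hx Hsad.
destruct (moments_le _ _ (mixture_moments _ Hmix)) as (H1 & H2 & H3).
fold a b in H1, H2, H3. unfold saddle_value, F. fold a b.
assert (Hh : x ^ 2 - 2 = sqrt (x ^ 2 - 2) ^ 2)
  by (rewrite pow2_sqrt; [ring|assert (H := le_sqrt2_sq x Hx); lra]).
rewrite Hh at 2. set (h := sqrt (x ^ 2 - 2)) in *.
assert (Hs2 := pow2_sqrt 2 ltac:(lra)).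
assert (Hs20 : 0 < sqrt 2) by (apply sqrt_lt_R0; lra).
assert (Hsb := pow2_sqrt b ltac:(lra)).
assert (Hsb0 : 0 < sqrt b) by (apply sqrt_lt_R0; lra).
assert (HAE : alpha2 beta = b + a - a ^ 2) by reflexivity.
set (A := alpha2 beta) in *. rewrite <- HAE. set (D := b - a + a ^ 2) in *.
assert (Hu : sqrt 2 * sqrt b * a * u = - (D * x + K * A * h)).
{ transitivity (- D * (sqrt 2 * (- u / threshold a b))).
  - unfold threshold. fold D. field. lra.
  - rewrite <- Hsad. field. lra. }
assert (Hu2 : u ^ 2 = (D * x + K * A * h) ^ 2 / (2 * a ^ 2 * b)).
{ transitivity ((sqrt 2 * sqrt b * a * u) ^ 2 / (2 * a ^ 2 * b)).
  - rewrite !Rpow_mult_distr, Hs2, Hsb. field. lra.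
  - rewrite Hu. field. lra. }
rewrite Hu2.
replace (2 * sqrt 2 * sqrt b * a / A * - x * u)
  with (2 / A * - x * (sqrt 2 * sqrt b * a * u)) by (field; lra).
rewrite Hu. unfold D. clearbody A. subst A. field. lra.
Qed.

Lemma saddle_point_level (k : nat) (u : R) : u <= - E_inf beta ->
  sqrt 2 <= saddle_point a b (INR k + 1) u /\
  saddle_point a b (INR k + 1) u
  + (INR k + 1) * alpha2 beta / (b - a + a ^ 2)
    * sqrt (saddle_point a b (INR k + 1) u ^ 2 - 2)
  = sqrt 2 * (- u / threshold a b).
Proof.
rewrite E_inf_threshold. intros Hu. apply saddle_point_spec; trivial.
- now apply mixture_moments.
- assert (Hk := pos_INR k). lra.
Qed.

Lemma lambda_starE (k : nat) (u : R) : u < - E_inf beta ->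
  lambda_star beta k u = - saddle_point a b (INR k + 1) u.
Proof.
intros Hu.
destruct (saddle_point_level k u ltac:(lra)) as [Hx1 Hx2].
assert (Hx := saddle_point_gt a b (INR k + 1) u (mixture_moments _ Hmix)
  ltac:(assert (Hk := pos_INR k); lra)
  ltac:(unfold a, b; rewrite <- E_inf_threshold; exact Hu)).
set (x := saddle_point _ _ _ _) in *.
destruct (moments_le _ _ (mixture_moments _ Hmix)) as (H1 & H2 & H3).
fold a b in H1, H2, H3.
assert (Hk := pos_INR k). assert (Hs2 : 0 < sqrt 2) by (apply sqrt_lt_R0; lra).
assert (Hsb0 : 0 < sqrt b) by (apply sqrt_lt_R0; lra).
assert (Hsb := pow2_sqrt b ltac:(lra)).
assert (Hr : 0 < (INR k + 1) * alpha2 beta / (b - a + a ^ 2)).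
{ apply Rdiv_lt_0_compat; [|exact H3]. apply Rmult_lt_0_compat; lra. }
assert (Hlev : sqrt 2 * (- u / threshold a b)
  = - (a * sqrt (2 * b) * u / (b - a + a ^ 2))).
{ rewrite sqrt_mult by lra. unfold threshold. field. lra. }
rewrite Hlev in Hx2.
assert (Heq : forall y, x + (INR k + 1) * alpha2 beta / (b - a + a ^ 2) * sqrt (x ^ 2 - 2)
    = y + (INR k + 1) * alpha2 beta / (b - a + a ^ 2) * sqrt (y ^ 2 - 2) <->
  a * sqrt (2 * b) / alpha2 beta * u - (b - a + a ^ 2) / alpha2 beta * - y
    + (INR k + 1) * sqrt (y ^ 2 - 2) = 0).
{ intros y. rewrite Hx2.
  replace (a * sqrt (2 * b) / alpha2 beta * u - (b - a + a ^ 2) / alpha2 beta * - y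
    + (INR k + 1) * sqrt (y ^ 2 - 2))
    with ((b - a + a ^ 2) / alpha2 beta *
      (y + (INR k + 1) * alpha2 beta / (b - a + a ^ 2) * sqrt (y ^ 2 - 2)
       + a * sqrt (2 * b) * u / (b - a + a ^ 2))) by (field; lra).
  split; intros E.
  - rewrite <- E. ring.
  - apply Rmult_integral in E. destruct E as [E|E]; [|lra].
    assert (0 < (b - a + a ^ 2) / alpha2 beta) by (apply Rdiv_lt_0_compat; lra). lra. }
unfold lambda_star. fold a b.
apply (@iota_unique R_AbsRing R_CompleteNormedModule).
- intros y (_ & Hy1 & Hy2). rewrite <- (Ropp_involutive y) in Hy2 at 1.
  replace (y ^ 2) with ((- y) ^ 2) in Hy2 by ring.
  apply Heq in Hy2. apply saddle_unique in Hy2; lra.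
- split; [|split].
  + assert (0 < sqrt (x ^ 2 - 2))
      by (apply sqrt_lt_R0; assert (H := lt_sqrt2_sq x Hx); lra). nra.
  + lra.
  + replace ((- x) ^ 2) with (x ^ 2) by ring. now apply Heq.
Qed.

Lemma theta_saddle (k : nat) (u : R) : u < - E_inf beta ->
  theta beta k u
  = 1 / 2 * ln (b / a) + F beta (- saddle_point a b (INR k + 1) u) u
    - (INR k + 1) * I1 (saddle_point a b (INR k + 1) u).
Proof.
intros Hu. unfold theta. destruct (Rle_dec (- E_inf beta) u) as [L|_]; [lra|].
destruct (saddle_point_level k u ltac:(lra)) as [Hx _]. assert (H := sqrt_pos 2).
rewrite lambda_starE by exact Hu. rewrite Rabs_Ropp, Rabs_pos_eq by lra. reflexivity.
Qed.

Lemma theta_upper (k : nat) (u : R) : - E_inf beta <= u ->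
  theta beta k u = upper_branch beta u.
Proof.
intros Hu. unfold theta. destruct (Rle_dec (- E_inf beta) u) as [_|L]; [|lra].
apply upper_branchE.
Qed.

Lemma theta_lower (k : nat) (u : R) : u <= - E_inf beta ->
  theta beta k u = lower_branch a b (INR k + 1) u.
Proof.
intros Hu. assert (Hk := pos_INR k).
assert (E := saddle_valueE (INR k + 1) (saddle_point a b (INR k + 1) u) u).
destruct (saddle_point_level k u Hu) as [H1 H2]. specialize (E H1 H2).
unfold lower_branch. rewrite <- E. destruct (Rle_lt_or_eq_dec _ _ Hu) as [L|L].
- now apply theta_saddle.
- assert (Hx : saddle_point a b (INR k + 1) u = sqrt 2).
  { rewrite L, E_inf_threshold. apply saddle_point_threshold; [|lra].
    now apply mixture_moments. }
  rewrite Hx, I1_sqrt2, theta_upper, <- upper_branchE by lra. fold a b. ring.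
Qed.

Lemma continuous_theta (k : nat) (u : R) : continuous (theta beta k) u.
Proof.
assert (Hk := pos_INR k).
assert (CL : u <= - E_inf beta -> continuous (lower_branch a b (INR k + 1)) u).
{ rewrite E_inf_threshold. intros Hu. apply continuous_lower_branch; trivial; [|lra].
  now apply mixture_moments. }
assert (CU := continuous_upper_branch beta u).
destruct (Rtotal_order u (- E_inf beta)) as [L|[L|L]].
- apply (continuous_ext_loc _ (lower_branch a b (INR k + 1))); [|apply CL; lra].
  apply (filter_imp (fun y => y < - E_inf beta)); [|now apply open_lt].
  intros y Hy. symmetry. apply theta_lower. lra.
- unfold continuous.
  apply (lim_glue _ (lower_branch a b (INR k + 1)) (upper_branch beta)).
  + apply filter_forall. intros y. destruct (Rle_dec y (- E_inf beta)) as [Hy|Hy].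
    * left. now apply theta_lower.
    * right. apply theta_upper. lra.
  + rewrite theta_lower by lra. apply CL. lra.
  + rewrite theta_upper by lra. exact CU.
- apply (continuous_ext_loc _ (upper_branch beta)); [|exact CU].
  apply (filter_imp (fun y => - E_inf beta < y)); [|now apply open_gt].
  intros y Hy. symmetry. apply theta_upper. lra.
Qed.

Lemma ex_derive_theta (k : nat) (u : R) : u <> - E_inf beta -> ex_derive (theta beta k) u.
Proof.
assert (Hk := pos_INR k). intros Hu. destruct (Rdichotomy _ _ Hu) as [L|L].
- apply (ex_derive_ext_loc (lower_branch a b (INR k + 1))).
  + apply (filter_imp (fun y => y < - E_inf beta)); [|now apply open_lt].
    intros y Hy. symmetry. apply theta_lower. lra.
  + apply ex_derive_lower_branch; [now apply mixture_moments|lra|].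
    unfold a, b. now rewrite <- E_inf_threshold.
- apply (ex_derive_ext_loc (upper_branch beta)).
  + apply (filter_imp (fun y => - E_inf beta < y)); [|now apply open_gt].
    intros y Hy. symmetry. apply theta_upper. lra.
  + unfold upper_branch, Rdiv. now auto_derive.
Qed.

Lemma upper_branch_sq (u : R) :
  upper_branch beta u
  = Sigma beta - (nu1 beta + nu2 beta) / (2 * alpha2 beta) * (u + E'_inf beta) ^ 2.
Proof.
unfold upper_branch.
assert (HsA := pow2_sqrt (alpha2 beta) ltac:(lra)).
assert (HsA0 : 0 < sqrt (alpha2 beta)) by (apply sqrt_lt_R0; lra).
rewrite <- HsA at 2. field. lra.
Qed.

Lemma upper_coef_pos : 0 < (nu1 beta + nu2 beta) / (2 * alpha2 beta).
Proof.
destruct (moments_le _ _ (mixture_moments _ Hmix)) as (H1 & H2 & _).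
apply Rdiv_lt_0_compat; lra.
Qed.

Lemma theta_increasing (k : nat) (u v : R) : u < v -> v <= - E'_inf beta ->
  theta beta k u < theta beta k v.
Proof.
intros Huv Hv. assert (Hk := pos_INR k).
assert (HL : forall u v, u < v -> v <= - E_inf beta -> theta beta k u < theta beta k v).
{ intros u' v' H1 H2. rewrite !theta_lower by lra.
  apply lower_branch_lt; trivial; [now apply mixture_moments|lra|].
  unfold a, b. now rewrite <- E_inf_threshold. }
assert (HU : forall u v, - E_inf beta <= u -> u < v -> v <= - E'_inf beta ->
  theta beta k u < theta beta k v).
{ intros u' v' H1 H2 H3. rewrite !theta_upper, !upper_branch_sq by lra.
  assert (Hc := upper_coef_pos).
  assert ((v' + E'_inf beta) ^ 2 < (u' + E'_inf beta) ^ 2) by nra. nra. }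
destruct (Rle_dec v (- E_inf beta)) as [H1|H1]; [now apply HL|].
destruct (Rle_dec (- E_inf beta) u) as [H2|H2]; [now apply HU|].
apply Rlt_trans with (theta beta k (- E_inf beta)); [apply HL|apply HU]; lra.
Qed.

Lemma theta_decreasing (k : nat) (u v : R) : - E'_inf beta <= u -> u < v ->
  theta beta k v < theta beta k u.
Proof.
intros Hu Huv. assert (H := E'_inf_lt_E_inf).
rewrite !theta_upper, !upper_branch_sq by lra. assert (Hc := upper_coef_pos).
assert ((u + E'_inf beta) ^ 2 < (v + E'_inf beta) ^ 2) by nra. nra.
Qed.

Lemma theta_E'_inf (k : nat) : theta beta k (- E'_inf beta) = Sigma beta.
Proof.
assert (H := E'_inf_lt_E_inf). rewrite theta_upper, upper_branch_sq by lra. ring.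
Qed.

Lemma E_inf_minus_root :
  - E'_inf beta < - E_inf_minus beta /\ upper_branch beta (- E_inf_minus beta) = 0.
Proof.
destruct (moments_le _ _ (mixture_moments _ Hmix)) as (H1 & H2 & H3).
assert (HS := Sigma_pos _ Hmix nu1_lt_nu2).
set (disc := 2 * alpha2 beta * (nu1 beta + nu2 beta) * Sigma beta).
assert (Hdisc : 0 < disc).
{ unfold disc. apply Rmult_lt_0_compat; [|exact HS]. apply Rmult_lt_0_compat; lra. }
assert (E : E_inf_minus beta = E'_inf beta - sqrt disc / (nu1 beta + nu2 beta)).
{ unfold E_inf_minus, E'_inf. replace (_ - (_ + _) * _) with disc; [field; lra|].
  unfold disc, Sigma. unfold alpha2. field. lra. }
assert (Hs : 0 < sqrt disc) by now apply sqrt_lt_R0.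
split.
- assert (0 < sqrt disc / (nu1 beta + nu2 beta)) by (apply Rdiv_lt_0_compat; lra). lra.
- rewrite upper_branch_sq, E.
  transitivity (Sigma beta - sqrt disc ^ 2 / (2 * alpha2 beta * (nu1 beta + nu2 beta))).
  + field. lra.
  + rewrite pow2_sqrt by lra. unfold disc. field. lra.
Qed.

Lemma theta_zeros (k : nat) : exists z, z < - E_inf_minus beta /\
  forall u, theta beta k u = 0 <-> (u = z \/ u = - E_inf_minus beta).
Proof.
assert (Hk := pos_INR k). assert (HE := E'_inf_lt_E_inf).
destruct E_inf_minus_root as [H1 H2].
destruct (lower_branch_neg a b (INR k + 1)) as (u0 & Hu0 & Hneg);
  [now apply mixture_moments|lra|].
unfold a, b in Hu0. rewrite <- E_inf_threshold in Hu0.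
rewrite <- theta_lower in Hneg by lra.
destruct (unique_zero (theta beta k) (- E'_inf beta) u0) as (z & Hz1 & Hz2).
- intros u v. apply theta_increasing.
- intros u _. apply continuous_theta.
- lra.
- exact Hneg.
- rewrite theta_E'_inf. apply Sigma_pos; [exact Hmix|exact nu1_lt_nu2].
- exists z. split; [lra|]. intros u.
  assert (HR : theta beta k (- E_inf_minus beta) = 0) by (rewrite theta_upper; lra).
  split.
  + intros Hu. destruct (Rle_dec u (- E'_inf beta)) as [L|L]; [left; now apply Hz2|].
    right. destruct (Rtotal_order u (- E_inf_minus beta)) as [M|[M|M]]; [|exact M|].
    * assert (H := theta_decreasing k u _ ltac:(lra) M). lra.
    * assert (H := theta_decreasing k (- E_inf_minus beta) u ltac:(lra) M). lra.
  + intros [E|E]; rewrite E; [|exact HR]. now apply Hz2; [lra|].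
Qed.

(** The saddle point is a maximum: F is concave in x and the rate is convex. *)
Lemma saddle_max (k : nat) (u y : R) : u <= - E_inf beta -> sqrt 2 <= y ->
  F beta (- y) u - (INR k + 1) * I1 y
  <= F beta (- saddle_point a b (INR k + 1) u) u
     - (INR k + 1) * I1 (saddle_point a b (INR k + 1) u).
Proof.
intros Hu Hy. assert (Hk := pos_INR k).
destruct (saddle_point_level k u Hu) as [Hx Hsad].
set (x := saddle_point _ _ _ _) in *.
destruct (moments_le _ _ (mixture_moments _ Hmix)) as (H1 & H2 & H3).
fold a b in H1, H2, H3.
assert (HI := I1_tangent y x Hy Hx). set (h := sqrt (x ^ 2 - 2)) in *.
assert (Hsb : 0 < sqrt b) by (apply sqrt_lt_R0; lra).
assert (Hsb2 := pow2_sqrt b ltac:(lra)).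
assert (Hs2 := pow2_sqrt 2 ltac:(lra)). assert (Hs20 := sqrt_lt_R0 2 ltac:(lra)).
set (D := b - a + a ^ 2) in *.
assert (Hlev : sqrt 2 * sqrt b * a * u = - (D * x + (INR k + 1) * alpha2 beta * h)).
{ transitivity (- D * (sqrt 2 * (- u / threshold a b))).
  - unfold threshold. fold D. field. lra.
  - rewrite <- Hsad. field. lra. }
assert (HF : F beta (- x) u - F beta (- y) u
  = D / (2 * alpha2 beta) * (x - y) ^ 2 + (INR k + 1) * (h * (x - y))).
{ unfold F. fold a b. fold D.
  transitivity (- / alpha2 beta * (x - y) * (sqrt 2 * sqrt b * a * u)
    - D / (2 * alpha2 beta) * (x ^ 2 - y ^ 2)); [field; lra|].
  rewrite Hlev. field. lra. }
assert (0 <= D / (2 * alpha2 beta) * (x - y) ^ 2).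
{ apply Rmult_le_pos; [|apply pow2_ge_0]. apply Rlt_le, Rdiv_lt_0_compat; lra. }
assert ((INR k + 1) * (I1 x - I1 y) <= (INR k + 1) * (h * (x - y)))
  by (apply Rmult_le_compat_l; lra).
lra.
Qed.

Lemma theta_lt (k k' : nat) (u : R) : (k < k')%nat -> u < - E_inf beta ->
  theta beta k' u < theta beta k u.
Proof.
intros Hkk Hu. apply lt_INR in Hkk. assert (Hk := pos_INR k).
rewrite !theta_saddle by exact Hu.
set (y := saddle_point a b (INR k' + 1) u).
assert (Hy : sqrt 2 < y).
{ apply saddle_point_gt; [now apply mixture_moments|lra|].
  unfold a, b. now rewrite <- E_inf_threshold. }
assert (HM := saddle_max k u y ltac:(lra) ltac:(lra)).
assert (HI := Rmult_lt_compat_r _ _ _ (I1_pos y Hy) Hkk). lra.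
Qed.

End PositiveAlpha.
(** * The limit alpha -> 0 *)

Global Instance alpha_to_0_filter (beta : nat -> R) : Filter (alpha_to_0 beta).
Proof.
split.
- now exists (mkposreal 1 Rlt_0_1).
- intros P Q [e1 H1] [e2 H2].
  exists (mkposreal _ (Rmin_stable_in_posreal e1 e2)). simpl. intros b Hb HA He Hp.
  split; [apply H1|apply H2]; trivial.
  + apply Rlt_le_trans with (1 := He), Rmin_l.
  + intros p. apply Rlt_le_trans with (1 := Hp p), Rmin_l.
  + apply Rlt_le_trans with (1 := He), Rmin_r.
  + intros p. apply Rlt_le_trans with (1 := Hp p), Rmin_r.
- intros P Q HPQ [e H]. exists e. intros b H1 H2 H3 H4. now apply HPQ, H.
Qed.

Lemma alpha_to_0_near (beta : nat -> R) (e : R) : 0 < e ->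
  alpha_to_0 beta (fun b => (mixture b /\ 0 < alpha2 b) /\ alpha2 b < e /\
                            forall p, Rabs (b p - beta p) < e).
Proof.
intros He. exists (mkposreal e He). simpl. intros b Hb HA H1 H2.
split; [split; [exact Hb|]|now split]. destruct (mixture_moments _ Hb) as [_ [H|H]]; [exact H|].
now destruct HA.
Qed.

Lemma alpha_to_0_mixture (beta : nat -> R) :
  alpha_to_0 beta (fun b => mixture b /\ 0 < alpha2 b).
Proof.
generalize (alpha_to_0_near beta 1 Rlt_0_1). apply filter_imp. now intros b [H _].
Qed.

Section PureLimit.
Variable beta : nat -> R.
Hypothesis Hmix : mixture beta.
Hypothesis HA : alpha2 beta = 0.

Lemma lim_alpha2 : filterlim alpha2 (alpha_to_0 beta) (locally 0).
Proof.
apply filterlim_locally. intros e. generalize (alpha_to_0_near beta e (cond_pos e)).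
apply filter_imp. intros b ([Hb Hb0] & H1 & H2).
change (Rabs (alpha2 b - 0) < e). rewrite Rminus_0_r, Rabs_pos_eq; [exact H1|now apply Rlt_le].
Qed.

Lemma lim_mean_deviation :
  filterlim (fun b => (nu1 b - nu1 beta) / sqrt (alpha2 b)) (alpha_to_0 beta) (locally 0).
Proof.
destruct (pure_mixture beta Hmix HA) as (p & Hp & Ha).
apply filterlim_locally. intros eps.
set (e := Rmin (1 / 2) (eps ^ 2 / 16)).
assert (He : 0 < e).
{ apply Rmin_pos; [lra|]. assert (H := pow_lt eps 2 (cond_pos eps)). lra. }
assert (He1 : e <= 1 / 2) by apply Rmin_l. assert (He2 : e <= eps ^ 2 / 16) by apply Rmin_r.
clearbody e.
generalize (alpha_to_0_near beta e He). apply filter_imp. intros b ([Hb Hb0] & _ & H2).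
specialize (H2 p). rewrite Hp in H2. apply Rabs_def2 in H2.
assert (Hd := mean_deviation b p Hb). rewrite <- Ha in Hd.
assert (Hq := weight_le_1 b p Hb). assert (Hbp := mixture_ge0 _ Hb p).
change (Rabs ((nu1 b - nu1 beta) / sqrt (alpha2 b) - 0) < eps). rewrite Rminus_0_r.
rewrite <- (Rabs_pos_eq eps) by apply Rlt_le, cond_pos.
apply Rsqr_lt_abs_0.
unfold Rsqr. set (d := nu1 b - nu1 beta) in *.
assert (Hs := sqrt_lt_R0 _ Hb0). assert (Hs2 := pow2_sqrt (alpha2 b) ltac:(lra)).
replace (d / sqrt (alpha2 b) * (d / sqrt (alpha2 b))) with (d ^ 2 / alpha2 b)
  by (rewrite <- Hs2 at 1; field; lra).
apply (Rmult_lt_reg_r (alpha2 b)); [exact Hb0|].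
unfold Rdiv at 1. rewrite Rmult_assoc, Rinv_l, Rmult_1_r by lra.
assert (H1 : 1 - b p ^ 2 <= 2 * e) by nra.
assert (H3 : 1 / 4 <= b p ^ 2) by nra.
assert (H4 : (1 - b p ^ 2) * alpha2 b <= 2 * e * alpha2 b)
  by (apply Rmult_le_compat_r; lra).
assert (H5 : 1 / 4 * d ^ 2 <= b p ^ 2 * d ^ 2)
  by (apply Rmult_le_compat_r; [apply pow2_ge_0|lra]).
assert (H6 : 0 < eps ^ 2) by apply pow_lt, cond_pos.
assert (H7 : 16 * e * alpha2 b <= eps ^ 2 * alpha2 b)
  by (apply Rmult_le_compat_r; lra).
assert (0 < e * alpha2 b) by now apply Rmult_lt_0_compat.
lra.
Qed.

Lemma lim_sd : filterlim (fun b => sqrt (alpha2 b)) (alpha_to_0 beta) (locally 0).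
Proof. rewrite <- sqrt_0. apply lim_sqrt, lim_alpha2. Qed.

Lemma lim_nu1 : filterlim nu1 (alpha_to_0 beta) (locally (nu1 beta)).
Proof.
apply (filterlim_ext_loc
  (fun b => nu1 beta + (nu1 b - nu1 beta) / sqrt (alpha2 b) * sqrt (alpha2 b))).
- generalize (alpha_to_0_mixture beta). apply filter_imp. intros b [_ Hb].
  apply sqrt_lt_R0 in Hb. field. lra.
- replace (locally (nu1 beta)) with (locally (nu1 beta + 0 * 0)) by (f_equal; ring).
  assert (H1 := lim_mean_deviation). assert (H2 := lim_sd).
  apply lim_plus; [apply filterlim_const|]. now apply lim_mult.
Qed.

Lemma lim_nu2 : filterlim nu2 (alpha_to_0 beta) (locally (nu2 beta)).
Proof.
apply (filterlim_ext (fun b => alpha2 b - nu1 b + nu1 b ^ 2)).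
- intros b. unfold alpha2. ring.
- replace (nu2 beta) with (0 - nu1 beta + nu1 beta ^ 2)
    by (rewrite <- HA; unfold alpha2; ring).
  assert (H1 := lim_nu1). assert (H2 := lim_alpha2). lim.
Qed.

Lemma pure_nu2 : nu2 beta = nu1 beta ^ 2 - nu1 beta.
Proof. unfold alpha2 in HA. lra. Qed.

Lemma pure_E_inf : E_inf beta = E'_inf beta.
Proof.
assert (H := E_inf_minus_E'_inf beta Hmix). rewrite HA in H.
unfold Rdiv in H. rewrite Rmult_0_r, Rmult_0_l in H. lra.
Qed.

Lemma lim_E'_inf : filterlim E'_inf (alpha_to_0 beta) (locally (E'_inf beta)).
Proof.
destruct (moments_le _ _ (mixture_moments _ Hmix)) as (Ha & Hb & _).
assert (H1 := lim_nu1). assert (H2 := lim_nu2). unfold E'_inf. lim. lra.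
Qed.

Lemma lim_E_inf : filterlim E_inf (alpha_to_0 beta) (locally (E_inf beta)).
Proof.
destruct (moments_le _ _ (mixture_moments _ Hmix)) as (Ha & Hb & _).
assert (Hs : 0 < sqrt (nu2 beta)) by (apply sqrt_lt_R0; lra).
assert (H1 := lim_nu1). assert (H2 := lim_nu2). unfold E_inf, alpha2. lim. nra.
Qed.

Lemma lim_Sigma : filterlim Sigma (alpha_to_0 beta) (locally (Sigma beta)).
Proof.
destruct (moments_le _ _ (mixture_moments _ Hmix)) as (Ha & Hb & _).
assert (H1 := lim_nu1). assert (H2 := lim_nu2). unfold Sigma.
assert (HL : filterlim (fun b => ln (nu2 b / nu1 b)) (alpha_to_0 beta)
               (locally (ln (nu2 beta / nu1 beta)))).
{ apply lim_ln; [apply Rdiv_lt_0_compat; lra|]. lim. lra. }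
lim; lra.
Qed.

(** E'_inf^2 is a rational function of (nu', alpha^2), so its increment is a
    combination of those of nu' and of alpha^2, both of which are negligible with
    respect to alpha. *)
Lemma lim_E'_inf_increment :
  filterlim (fun b => (E'_inf b - E'_inf beta) / sqrt (alpha2 b))
    (alpha_to_0 beta) (locally 0).
Proof.
assert (HM := mixture_moments _ Hmix).
destruct (moments_le _ _ HM) as (Ha & Hb & _).
assert (HE := E'_inf_pos _ Hmix). assert (Hp := pure_nu2).
set (a0 := nu1 beta) in *.
(* Coefficients of alpha^2 and of nu' - a0 in the increment of E'_inf^2: N1 for the change
   of alpha^2 at fixed nu', then N2 for the change of nu' at alpha = 0. *)
pose (N1 := fun b => 4 * (2 * nu1 b ^ 2 - nu1 b ^ 3 - (nu1 b - 1) * alpha2 b)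
                      / (nu1 b * (alpha2 b + nu1 b ^ 2) ^ 2)).
pose (N2 := fun b => 4 / (nu1 b * a0)).
apply (filterlim_ext_loc (fun b =>
  (sqrt (alpha2 b) * N1 b + (nu1 b - a0) / sqrt (alpha2 b) * N2 b)
  / (E'_inf b + E'_inf beta))).
- generalize (alpha_to_0_mixture beta). apply filter_imp. intros b [Hbm Hb0].
  assert (HE' := E'_inf_pos _ Hbm). assert (HMb := mixture_moments _ Hbm).
  destruct (moments_le _ _ HMb) as (Ha' & Hb' & _).
  assert (Hs := sqrt_lt_R0 _ Hb0). assert (Hs2 := pow2_sqrt (alpha2 b) ltac:(lra)).
  assert (Hsq : forall c, mixture c ->
    E'_inf c ^ 2 = 4 * nu1 c ^ 2 * nu2 c / (nu1 c + nu2 c) ^ 2).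
  { intros c Hc. destruct (moments_le _ _ (mixture_moments _ Hc)) as (Hc1 & Hc2 & _).
    transitivity (4 * nu1 c ^ 2 * sqrt (nu2 c) ^ 2 / (nu1 c + nu2 c) ^ 2).
    - unfold E'_inf. field. lra.
    - now rewrite pow2_sqrt by lra. }
  assert (Hdiff : E'_inf b ^ 2 - E'_inf beta ^ 2 = alpha2 b * N1 b + (nu1 b - a0) * N2 b).
  { rewrite !Hsq by assumption. rewrite Hp. fold a0.
    replace (nu2 b) with (alpha2 b - nu1 b + nu1 b ^ 2) by (unfold alpha2; ring).
    unfold N1, N2. field. repeat split; nra. }
  transitivity ((sqrt (alpha2 b) ^ 2 * N1 b + (nu1 b - a0) * N2 b)
    / (sqrt (alpha2 b) * (E'_inf b + E'_inf beta))).
  + field. lra.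
  + rewrite Hs2, <- Hdiff. field. lra.
- replace 0 with ((0 * (4 * (2 * a0 ^ 2 - a0 ^ 3 - (a0 - 1) * 0)
      / (a0 * (0 + a0 ^ 2) ^ 2)) + 0 * (4 / (a0 * a0)))
      / (E'_inf beta + E'_inf beta)) by (field; nra).
  assert (H1 : filterlim nu1 (alpha_to_0 beta) (locally a0)) by exact lim_nu1.
  assert (H2 := lim_alpha2). assert (H3 := lim_sd). assert (H5 := lim_E'_inf).
  assert (H4 : filterlim (fun b => (nu1 b - a0) / sqrt (alpha2 b)) (alpha_to_0 beta)
    (locally 0)) by exact lim_mean_deviation.
  assert (D1 : a0 * (0 + a0 ^ 2) ^ 2 <> 0).
  { apply Rgt_not_eq, Rmult_lt_0_compat; [lra|]. apply pow_lt. nra. }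
  assert (D2 : a0 * a0 <> 0) by nra.
  unfold N1, N2.
  apply lim_div; [lra| |lim].
  apply lim_plus; apply lim_mult; trivial; lim; assumption.
Qed.

Definition pure_complexity (k : nat) (u : R) : Rbar :=
  if Rle_dec u (- E_inf beta)
  then Finite (lower_branch (nu1 beta) (nu2 beta) (INR k + 1) u) else m_infty.

Lemma pure_complexity_lower (k : nat) (u : R) : u <= - E_inf beta ->
  pure_complexity k u = Finite (lower_branch (nu1 beta) (nu2 beta) (INR k + 1) u).
Proof. intros H. unfold pure_complexity. now destruct (Rle_dec u (- E_inf beta)). Qed.

Lemma pure_complexity_upper (k : nat) (u : R) : - E_inf beta < u ->
  pure_complexity k u = m_infty.
Proof.
intros H. unfold pure_complexity. destruct (Rle_dec u (- E_inf beta)); [lra|easy].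
Qed.

Lemma lower_branch_E_inf (K : R) : 0 <= K ->
  lower_branch (nu1 beta) (nu2 beta) K (- E_inf beta) = Sigma beta.
Proof.
intros HK. rewrite E_inf_threshold, lower_branch_threshold;
  [|now apply mixture_moments|exact HK].
destruct (moments_le _ _ (mixture_moments _ Hmix)) as (Ha & Hb & _).
unfold Sigma. f_equal. rewrite pure_nu2. field. split; nra.
Qed.

Lemma lim_lower_branch_pure (k : nat) (u : R) : u <= - E_inf beta ->
  filterlim (fun b => lower_branch (nu1 b) (nu2 b) (INR k + 1) u) (alpha_to_0 beta)
    (locally (lower_branch (nu1 beta) (nu2 beta) (INR k + 1) u)).
Proof.
rewrite E_inf_threshold. intros Hu. assert (Hk := pos_INR k).
apply (lim_lower_branch nu1 nu2 (fun _ => u)); trivial; try lra.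
- now apply mixture_moments.
- exact lim_nu1.
- exact lim_nu2.
- apply filterlim_const.
Qed.

Lemma lim_upper_branch_E_inf :
  filterlim (fun b => upper_branch b (- E_inf beta)) (alpha_to_0 beta)
    (locally (Sigma beta)).
Proof.
unfold upper_branch.
replace (Sigma beta)
  with (Sigma beta - (nu1 beta + nu2 beta) / 2 * 0 ^ 2) by ring.
assert (H1 := lim_nu1). assert (H2 := lim_nu2). assert (H3 := lim_Sigma).
apply lim_minus; [exact H3|]. apply lim_mult; [lim; lra|]. apply lim_pow.
apply (filterlim_ext (fun b => (E'_inf b - E'_inf beta) / sqrt (alpha2 b)));
  [|exact lim_E'_inf_increment].
intros b. rewrite pure_E_inf. unfold Rdiv. ring.
Qed.

Lemma lim_upper_branch_infty (u : R) : - E_inf beta < u ->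
  filterlim (fun b => upper_branch b u) (alpha_to_0 beta) (Rbar_locally m_infty).
Proof.
intros Hu P [M HP].
destruct (moments_le _ _ (mixture_moments _ Hmix)) as (Ha & Hb & _).
(* The function alpha^2 (upper_branch - M), whose limit is negative. *)
assert (L : filterlim
  (fun b => alpha2 b * (Sigma b - M) - (nu1 b + nu2 b) / 2 * (u + E'_inf b) ^ 2)
  (alpha_to_0 beta)
  (locally (0 * (Sigma beta - M) - (nu1 beta + nu2 beta) / 2 * (u + E'_inf beta) ^ 2))).
{ assert (H1 := lim_nu1). assert (H2 := lim_nu2). assert (H3 := lim_Sigma).
  assert (H4 := lim_alpha2). assert (H5 := lim_E'_inf). lim. }
apply (lim_lt _ _ 0) in L.
- unfold filtermap. generalize (filter_and _ _ (alpha_to_0_mixture beta) L).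
  apply filter_imp. intros b [[Hbm Hb0] HL]. apply HP. rewrite upper_branch_sq by exact Hb0.
  apply (Rmult_lt_reg_l (alpha2 b)); [exact Hb0|].
  apply Rminus_lt. refine (Rle_lt_trans _ _ _ (Req_le _ _ _) HL). field. lra.
- rewrite pure_E_inf in Hu. assert (0 < (u + E'_inf beta) ^ 2) by (apply pow_lt; lra). nra.
Qed.

Lemma pure_complexity_correct (k : nat) : is_pure_complexity beta k (pure_complexity k).
Proof.
intros u. destruct (Rtotal_order u (- E_inf beta)) as [L|[L|L]].
- rewrite pure_complexity_lower by lra.
  apply (filterlim_ext_loc (fun b => lower_branch (nu1 b) (nu2 b) (INR k + 1) u)).
  + assert (HN := lim_gt _ _ u (lim_opp _ _ lim_E_inf) L).
    generalize (filter_and _ _ (alpha_to_0_mixture beta) HN). apply filter_imp.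
    intros b [[Hbm Hb0] Hbu]. symmetry. apply theta_lower; trivial. lra.
  + apply lim_lower_branch_pure. lra.
- rewrite pure_complexity_lower by lra. assert (Hk := pos_INR k).
  apply (lim_glue _ (fun b => lower_branch (nu1 b) (nu2 b) (INR k + 1) u)
    (fun b => upper_branch b u)).
  + generalize (alpha_to_0_mixture beta). apply filter_imp. intros b [Hbm Hb0].
    destruct (Rle_dec u (- E_inf b)) as [Hu|Hu].
    * left. now apply theta_lower.
    * right. apply theta_upper; trivial. lra.
  + apply lim_lower_branch_pure. lra.
  + rewrite L, lower_branch_E_inf by lra. exact lim_upper_branch_E_inf.
- rewrite pure_complexity_upper by lra.
  apply (filterlim_ext_loc (fun b => upper_branch b u)); [|now apply lim_upper_branch_infty].
  assert (HN := lim_lt _ _ u (lim_opp _ _ lim_E_inf) L).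
  generalize (filter_and _ _ (alpha_to_0_mixture beta) HN). apply filter_imp.
  intros b [[Hbm Hb0] Hbu]. symmetry. apply theta_upper; trivial. lra.
Qed.

Lemma pure_complexity_increasing (k : nat) (u v : R) : u < v -> v <= - E_inf beta ->
  Rbar_lt (pure_complexity k u) (pure_complexity k v).
Proof.
intros Huv Hv. assert (Hk := pos_INR k). rewrite !pure_complexity_lower by lra.
apply lower_branch_lt; [now apply mixture_moments|lra|exact Huv|].
now rewrite <- E_inf_threshold.
Qed.

Lemma pure_complexity_lt (k k' : nat) (u : R) : (k < k')%nat -> u < - E_inf beta ->
  Rbar_lt (pure_complexity k' u) (pure_complexity k u).
Proof.
intros Hkk Hu. apply lt_INR in Hkk. assert (Hk := pos_INR k).
rewrite !pure_complexity_lower by lra. simpl.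
unfold lower_branch.
assert (E : forall K, saddle_point (nu1 beta) (nu2 beta) K u
  = saddle 0 (- u / threshold (nu1 beta) (nu2 beta))).
{ intros K. unfold saddle_point. fold (alpha2 beta). rewrite HA. f_equal.
  unfold Rdiv. ring. }
assert (Hx := saddle_point_gt (nu1 beta) (nu2 beta) 0 u (mixture_moments _ Hmix)
  (Rle_refl 0) ltac:(rewrite <- E_inf_threshold; exact Hu)).
rewrite E in Hx. rewrite !E. set (x := saddle 0 _) in *.
unfold saddle_value. fold (alpha2 beta). rewrite HA.
assert (HI := Rmult_lt_compat_r _ _ _ (I1_pos x Hx) Hkk).
rewrite !Rmult_0_r, !Rmult_0_l. lra.
Qed.

Lemma pure_complexity_zero (k : nat) : nu1 beta <> nu2 beta ->
  exists z, z < - E_inf_minus beta /\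
    forall u, pure_complexity k u = Finite 0 <-> u = z.
Proof.
intros Hne. assert (Hk := pos_INR k). assert (HM := mixture_moments _ Hmix).
destruct (moments_le _ _ HM) as (Ha & Hb & _).
assert (HS := Sigma_pos _ Hmix ltac:(lra)).
destruct (lower_branch_neg _ _ (INR k + 1) HM) as (u0 & Hu0 & Hneg); [lra|].
rewrite <- E_inf_threshold in Hu0.
destruct (unique_zero (lower_branch (nu1 beta) (nu2 beta) (INR k + 1)) (- E_inf beta) u0)
  as (z & Hz1 & Hz2); trivial.
- intros u v Huv. rewrite E_inf_threshold. intros Hv. apply lower_branch_lt; trivial. lra.
- intros u. rewrite E_inf_threshold. intros Hv. apply continuous_lower_branch; trivial. lra.
- rewrite lower_branch_E_inf by lra. exact HS.
- exists z. split.
  + replace (E_inf_minus beta) with (E_inf beta); [exact Hz1|].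
    rewrite pure_E_inf. unfold E_inf_minus, E'_inf. rewrite HA.
    replace (4 * nu2 beta * nu1 beta ^ 2 - _) with 0.
    * rewrite sqrt_0, Rminus_0_r. reflexivity.
    * rewrite pure_nu2. ring.
  + intros u. destruct (Rle_dec u (- E_inf beta)) as [L|L].
    * rewrite pure_complexity_lower by exact L. rewrite <- Hz2 by exact L. split.
      -- intros E. now injection E.
      -- now intros ->.
    * rewrite pure_complexity_upper by lra. split; [discriminate|intros E; lra].
Qed.

End PureLimit.

Theorem proposition1 :
  forall beta : nat -> R, mixture beta ->
  (alpha2 beta <> 0 ->
    (forall k : nat,
      (* (1) *)
      ((forall u : R, continuous (theta beta k) u) /\
       (forall u : R, u <> - E_inf beta -> ex_derive (theta beta k) u)) /\
      (* (2) *)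
      ((forall u v : R, u < v -> v < - E'_inf beta ->
          theta beta k u < theta beta k v) /\
       (forall u v : R, - E'_inf beta < u -> u < v ->
          theta beta k v < theta beta k u) /\
       (forall u : R, u <> - E'_inf beta ->
          theta beta k u < theta beta k (- E'_inf beta)) /\
       theta beta k (- E'_inf beta) = Sigma beta /\
       0 < Sigma beta) /\
      (* (3) *)
      (exists z : R, z < - E_inf_minus beta /\
         forall u : R, theta beta k u = 0 <-> (u = z \/ u = - E_inf_minus beta))) /\
    (forall k k' : nat, (k < k')%nat ->
      (* (4) *)
      (forall u : R, u < - E_inf beta -> theta beta k u > theta beta k' u) /\
      (* (5) *)
      (forall u : R, - E_inf beta <= u -> theta beta k u = theta beta k' u)))
  /\
  (alpha2 beta = 0 ->
    exists f : nat -> R -> Rbar,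
    (forall k : nat, is_pure_complexity beta k (f k)) /\
    (forall k : nat,
      (* (1) *)
      ((forall u : R, u <= - E_inf beta -> is_finite (f k u)) /\
       (forall u : R, - E_inf beta < u -> f k u = m_infty) /\
       filterlim (fun u : R => real (f k u)) (at_left (- E_inf beta))
         (locally (real (f k (- E_inf beta)))) /\
       (forall u : R, u < - E_inf beta -> ex_derive (fun v : R => real (f k v)) u)) /\
      (* (2) *)
      ((forall u v : R, u < v -> v < - E'_inf beta -> Rbar_lt (f k u) (f k v)) /\
       (forall u : R, u <> - E'_inf beta ->
          Rbar_lt (f k u) (f k (- E'_inf beta))) /\
       f k (- E'_inf beta) = Finite (Sigma beta) /\
       (nu1 beta <> nu2 beta -> 0 < Sigma beta)) /\
      (* (3) *)
      (nu1 beta <> nu2 beta ->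
       exists z : R, z < - E_inf_minus beta /\
         forall u : R, f k u = Finite 0 <-> u = z)) /\
    (forall k k' : nat, (k < k')%nat ->
      (* (4) *)
      (forall u : R, u < - E_inf beta -> Rbar_lt (f k' u) (f k u)) /\
      (* (5) *)
      (forall u : R, - E_inf beta <= u -> f k u = f k' u))).
Proof.
intros beta Hmix. split.
- intros Hne.
  assert (HA : 0 < alpha2 beta).
  { destruct (mixture_moments _ Hmix) as [_ [H|H]]; [exact H|now destruct Hne]. }
  split.
  + intros k. split; [|split].
    * split; [apply continuous_theta|apply ex_derive_theta]; assumption.
    * split; [|split; [|split; [|split]]].
      -- intros u v Huv Hv. apply theta_increasing; trivial. lra.
      -- intros u v Hu Huv. apply theta_decreasing; trivial. lra.
      -- intros u Hu. destruct (Rdichotomy _ _ Hu) as [L|L].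
         ++ apply theta_increasing; trivial. lra.
         ++ apply theta_decreasing; trivial. lra.
      -- now apply theta_E'_inf.
      -- apply Sigma_pos; trivial. now apply nu1_lt_nu2.
    * now apply theta_zeros.
  + intros k k' Hkk. split; intros u Hu.
    * now apply theta_lt.
    * now rewrite !theta_upper.
- intros HA. exists (pure_complexity beta). split; [|split].
  + intros k. now apply pure_complexity_correct.
  + intros k. assert (Hk := pos_INR k). assert (HE := pure_E_inf beta Hmix HA).
    assert (HM := mixture_moments _ Hmix).
    split; [|split].
    * split; [|split; [|split]].
      -- intros u Hu. now rewrite pure_complexity_lower.
      -- intros u Hu. now apply pure_complexity_upper.
      -- rewrite pure_complexity_lower by lra. simpl.
         apply (filterlim_ext_loc (lower_branch (nu1 beta) (nu2 beta) (INR k + 1))).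
         ++ exists (mkposreal 1 Rlt_0_1). intros y _ Hy.
            now rewrite pure_complexity_lower by lra.
         ++ apply (filterlim_filter_le_1 (F := locally (- E_inf beta)));
           [apply filter_le_within|].
            rewrite E_inf_threshold. apply continuous_lower_branch; trivial; lra.
      -- intros u Hu.
         apply (ex_derive_ext_loc (lower_branch (nu1 beta) (nu2 beta) (INR k + 1))).
         ++ apply (filter_imp (fun y => y < - E_inf beta)); [|now apply open_lt].
            intros y Hy. now rewrite pure_complexity_lower by lra.
         ++ rewrite E_inf_threshold in Hu. apply ex_derive_lower_branch; trivial. lra.
    * assert (HP : pure_complexity beta k (- E'_inf beta) = Finite (Sigma beta)).
      { rewrite <- HE, pure_complexity_lower by lra.
        f_equal. apply lower_branch_E_inf; trivial. lra. }
      split; [|split; [|split]].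
      -- intros u v Huv Hv. apply pure_complexity_increasing; trivial. lra.
      -- intros u Hu. destruct (Rdichotomy _ _ Hu) as [L|L].
         ++ apply pure_complexity_increasing; trivial. lra.
         ++ rewrite HP, pure_complexity_upper by lra. exact I.
      -- exact HP.
      -- intros Hab. destruct (moments_le _ _ HM) as (_ & H2 & _).
         apply Sigma_pos; trivial. lra.
    * now apply pure_complexity_zero.
  + intros k k' Hkk. split; intros u Hu.
    * now apply pure_complexity_lt.
    * destruct (Rle_lt_or_eq_dec _ _ Hu) as [L|L].
      -- now rewrite !pure_complexity_upper.
      -- assert (H1 := pos_INR k). assert (H2 := pos_INR k').
         rewrite <- L, !pure_complexity_lower, !lower_branch_E_inf by (trivial; lra).
         reflexivity.
Qed.
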